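(* Let $\mathcal X\to\mathrm{Spec}\,A$ be a deformation of the curve $X$ over a local integral domain $A$, with $G\subset\mathrm{Aut}(X)$ acting fibrewise on $\mathcal X$, and let $P$ be a wildly ramified point on the special fibre of $\mathcal X$. Suppose that there is a sequence of $G$-invariant invertible $\mathcal O_{\mathcal X}$-modules $\mathcal L_i$, $1\le i\le m$, such that the corresponding spaces of global sections $L_i:=\Gamma(\mathcal X,\mathcal L_i)$ satisfy $$L_1\subset L_2\subset\cdots\subset L_m,$$ the $L_i$ are finitely generated free $A$-modules, and $L_i\otimes_Ak=L(iP)$. Then the faithful representation $\rho:G_1(P)\to\mathrm{GL}(L(mP))$ can be lifted to a representation $$\rho_1:G_1(P)\to \mathrm{GL}_n(A),\qquad n=\dim_kL(mP),$$ such that for every $\sigma\in G_1(P)$ the matrix $\rho_1(\sigma)$ is lower triangular with $1$ on the diagonal.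
   Context: $k$ is an algebraically closed field of characteristic $p>0$, $X$ a nonsingular projective curve over $k$ of genus $g\ge2$, $G\subset\mathrm{Aut}(X)$ a group of $p$-power order. $A$ is a $k$-algebra with residue field $k$. A deformation of $(X,G)$ over $A$ is a proper smooth family of curves $\mathcal X\to\mathrm{Spec}\,A$ with a homomorphism $G\to\mathrm{Aut}_A(\mathcal X)$ and a $G$-equivariant isomorphism of the special fibre with $X$. $G_0(P)$ is the stabilizer of $P$, and $G_1(P)=G_0(P)$ its $p$-part. $L(iP)=\{f\in k(X):\mathrm{div}(f)+iP\ge0\}$. A pole number at $P$ is an integer $i\ge0$ with $i=0$ or $L((i-1)P)\subsetneq L(iP)$; $m\le2g-1$ is the smallest pole number not divisible by $p$. $\rho:G_1(P)\to\mathrm{GL}(L(mP))$ is the natural action on functions, which is faithful, written in matrix form with respect to a basis adapted to the flag $L(0)\subset L(P)\subset\cdots\subset L(mP)$. ''Lifted'' means that $\rho_1$ reduces to $\rho$ modulo the maximal ideal of $A$. *)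

(* Defs.v *)
From HB Require Import structures.
From mathcomp Require Import all_boot all_order all_algebra all_fingroup all_solvable.
From mathcomp Require Import mxrepresentation.
From mathcomp Require Import all_classical.
From mathcomp Require Import topology.

Set Implicit Arguments.
Unset Strict Implicit.
Unset Printing Implicit Defensive.

Import GRing.Theory.
Local Open Scope classical_set_scope.
Local Open Scope ring_scope.

Record opens (X : topologicalType) := Opens {
  carrier :> set X;
  carrier_open : open carrier }.

Definition inside (X : topologicalType) (U : opens X) : X -> Prop := carrier U.
Coercion inside : opens >-> Funclass.

Definition opT (X : topologicalType) : opens X := Opens (@openT X).

Definition pre (X Y : topologicalType) (f : X -> Y) (cf : continuous f)
    (U : opens Y) : opens X :=
  Opens (proj1 (@continuousP X Y f) cf (carrier U) (carrier_open U)).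

(* Compatibility is required on every open set contained in two members of the
   covering, equivalently on their intersection. *)
Definition is_sheaf (X : topologicalType) (F : opens X -> Type)
    (r : forall U V : opens X, V `<=` U -> F U -> F V) : Prop :=
  forall (I : Type) (C : I -> opens X) (U : opens X)
         (hC : forall i, C i `<=` U),
    U `<=` [set x | exists i, C i x] ->
    forall s : forall i, F (C i),
      (forall i j (W : opens X) (hi : W `<=` C i) (hj : W `<=` C j),
          r _ _ hi (s i) = r _ _ hj (s j)) ->
      exists! t : F U, forall i, r _ _ (hC i) t = s i.

(* Section rings may be zero (they are on the empty set), hence comPzRingType. *)
Record ringed_space := RingedSpace {
  points :> topologicalType;
  sec : opens points -> comPzRingType;
  res : forall U V : opens points, V `<=` U -> {rmorphism sec U -> sec V};
  res_id : forall (U : opens points) (h : U `<=` U) s, res h s = s;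
  res_comp : forall (U V W : opens points)
    (h : V `<=` U) (h' : W `<=` V) (h'' : W `<=` U) s,
    res h' (res h s) = res h'' s;
  sec_sheaf : is_sheaf (fun U V h => @res U V h) }.

Arguments sec {_} _.
Arguments res {_ U V} _.

Definition invertible (B : comPzRingType) (f : B) : Prop := exists g, f * g = 1.

(* x lies in U and the germ of f at x is a unit of the stalk. *)
Definition unit_at (X : ringed_space) (U : opens X) (f : sec U) (x : X) : Prop :=
  exists (V : opens X) (h : V `<=` U), V x /\ invertible (res h f).

Definition prime_ideal (B : comPzRingType) (I : set B) : Prop :=
  [/\ I 0, (forall a b, I a -> I b -> I (a + b)),
      (forall a b, I b -> I (a * b)), ~ I 1
    & (forall a b, I (a * b) -> I a \/ I b)].

(* The canonical morphism U -> Spec O(U), sending x to the prime ideal of the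
   sections whose germ at x is not a unit, is an isomorphism: it is bijective,
   the distinguished open sets D(g) = {x in U | g_x is a unit} form a basis of
   the topology of U, and O(D(g)) is the localization O(U)_g. *)
Definition is_affine (X : ringed_space) (U : opens X) : Prop :=
  [/\ set_bij U [set I : set (sec U) | prime_ideal I]
        (fun x => [set g : sec U | ~ unit_at g x]),
      (forall (V : opens X) x, V `<=` U -> V x ->
         exists2 g : sec U, unit_at g x & [set y | unit_at g y] `<=` V)
    & (forall (g : sec U) (W : opens X) (h : W `<=` U),
         (forall x, W x <-> unit_at g x) ->
         (forall s : sec W, exists n (t : sec U), res h g ^+ n * s = res h t) /\
         (forall t : sec U, res h t = 0 -> exists n, g ^+ n * t = 0))].

Record scheme := Scheme {
  space :> ringed_space;
  locally_affine : forall x : space, exists2 U : opens space, is_affine U & U x }.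

Record mor (X Y : scheme) := Mor {
  fn :> X -> Y;
  fn_cont : continuous fn;
  comap : forall U : opens Y, {rmorphism sec U -> sec (pre fn_cont U)};
  comap_res : forall (U V : opens Y) (h : V `<=` U)
    (h' : pre fn_cont V `<=` pre fn_cont U) s,
    comap V (res h s) = res h' (comap U s);
  (* the induced homomorphisms of stalks are local *)
  comap_local : forall (U : opens Y) (s : sec U) x,
    unit_at (comap U s) x -> unit_at s (fn x) }.

Arguments comap {_ _} _ _.

Definition mpre (X Y : scheme) (f : mor X Y) (U : opens Y) : opens X :=
  pre (@fn_cont _ _ f) U.

Lemma id_cont (X : topologicalType) : continuous (fun x : X => x).
Proof. by move=> x. Qed.

Lemma id_sub (X : topologicalType) (U : opens X) :
  pre (@id_cont X) U `<=` U.
Proof. by []. Qed.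

Definition mor_id (X : scheme) : mor X X.
Proof.
refine (@Mor X X (fun x => x) (@id_cont X) (fun U => res (@id_sub X U)) _ _).
- move=> U V h h' s.
  have k : pre (@id_cont X) V `<=` U by apply: subset_trans h.
  by rewrite !(res_comp _ _ k).
- move=> U s x [V [h [Vx u]]].
  have k : V `<=` U by [].
  by exists V, k; split=> //; move: u; rewrite (res_comp _ _ k).
Defined.

Lemma comp_cont (X Y Z : scheme) (g : mor Y Z) (f : mor X Y) :
  continuous (fun x => g (f x)).
Proof. by move=> x; apply: (continuous_comp (@fn_cont _ _ f x) (@fn_cont _ _ g _)). Qed.

Lemma comp_sub (X Y Z : scheme) (g : mor Y Z) (f : mor X Y) (U : opens Z) :
  pre (@comp_cont _ _ _ g f) U `<=` mpre f (mpre g U).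
Proof. by []. Qed.

Definition mor_comp (X Y Z : scheme) (g : mor Y Z) (f : mor X Y) : mor X Z.
Proof.
refine (@Mor X Z (fun x => g (f x)) (@comp_cont _ _ _ g f)
  (fun U => GRing.RMorphism.clone _ _
     (res (@comp_sub _ _ _ g f U) \o (comap f (mpre g U) \o comap g U)) _) _ _).
- move=> U V h h' s /=.
  have k1 : mpre g V `<=` mpre g U by move=> y; apply: h.
  have k2 : mpre f (mpre g V) `<=` mpre f (mpre g U) by move=> y; apply: h.
  rewrite (comap_res h k1) (comap_res k1 k2).
  have k : pre (@comp_cont _ _ _ g f) V `<=` mpre f (mpre g U) by move=> y; apply: h.
  by rewrite !(res_comp _ _ k).
- move=> U s x [V [h [Vx u]]].
  apply: comap_local; apply: comap_local.
  have k : V `<=` mpre f (mpre g U) by [].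
  by exists V, k; split=> //; move: u; rewrite (res_comp _ _ k).
Defined.

Definition is_pullback (Z X T Y : scheme) (p : mor Z X) (q : mor Z T)
    (f : mor X Y) (t : mor T Y) : Prop :=
  mor_comp f p = mor_comp t q /\
  forall (W : scheme) (a : mor W X) (b : mor W T),
    mor_comp f a = mor_comp t b ->
    exists! h : mor W Z, mor_comp p h = a /\ mor_comp q h = b.

(* A spectrum of R: an affine scheme with ring of global functions R. *)
Record spec (R : comPzRingType) := MkSpec {
  spec_scheme :> scheme;
  spec_affine : is_affine (opT spec_scheme);
  spec_iso : {rmorphism R -> sec (opT spec_scheme)};
  spec_iso_bij : bijective spec_iso }.

Arguments spec_iso {_} _.

Lemma sub_mpreT (X Y : scheme) (f : mor X Y) (U : opens X) :
  U `<=` mpre f (opT Y).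
Proof. by []. Qed.

(* The R-algebra structure of O_X(U), for X over Spec R. *)
Definition scal (R : comPzRingType) (S : spec R) (X : scheme) (f : mor X S)
    (U : opens X) : {rmorphism R -> sec U} :=
  GRing.RMorphism.clone _ _
    (res (@sub_mpreT X S f U) \o (comap f (opT S) \o spec_iso S)) _.

Definition is_spec_map (R R' : comPzRingType) (S : spec R) (S' : spec R')
    (phi : {rmorphism R -> R'}) (e : mor S' S) : Prop :=
  forall a : R, scal e (opT S') a = spec_iso S' (phi a).

Inductive pexpr (R : Type) (n : nat) :=
  | PConst of R | PVar of 'I_n
  | PAdd of pexpr R n & pexpr R n | PMul of pexpr R n & pexpr R n.

Fixpoint peval (R B : comPzRingType) (n : nat) (phi : R -> B) (b : 'I_n -> B)
    (e : pexpr R n) : B :=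
  match e with
  | PConst c => phi c
  | PVar i => b i
  | PAdd e1 e2 => peval phi b e1 + peval phi b e2
  | PMul e1 e2 => peval phi b e1 * peval phi b e2
  end.

Definition finite_type (R B : comPzRingType) (phi : {rmorphism R -> B}) : Prop :=
  exists n (b : 'I_n -> B), forall y : B, exists e : pexpr R n, y = peval phi b e.

(* B = R[x_1, .., x_n] / (r_1, .., r_l), through its universal property. *)
Definition finite_presentation (R B : comPzRingType)
    (phi : {rmorphism R -> B}) : Prop :=
  exists n l (b : 'I_n -> B) (r : 'I_l -> pexpr R n),
    (forall j, peval phi b (r j) = 0) /\
    forall (C : comPzRingType) (psi : {rmorphism R -> C}) (c : 'I_n -> C),
      (forall j, peval psi c (r j) = 0) ->
      exists! h : {rmorphism B -> C},
        (forall a, h (phi a) = psi a) /\ (forall i, h (b i) = c i).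

Definition formally_smooth (R B : comPzRingType)
    (phi : {rmorphism R -> B}) : Prop :=
  forall (C D : comPzRingType) (q : {rmorphism C -> D})
         (psi : {rmorphism R -> C}) (h0 : {rmorphism B -> D}),
    (forall d, exists c, q c = d) ->
    (forall c c', q c = 0 -> q c' = 0 -> c * c' = 0) ->
    (forall a, h0 (phi a) = q (psi a)) ->
    exists h : {rmorphism B -> C},
      (forall a, h (phi a) = psi a) /\ (forall b, q (h b) = h0 b).

Definition local_map (X Y : scheme) (f : mor X Y) (U : opens X) (V : opens Y)
    (h : U `<=` mpre f V) : {rmorphism sec V -> sec U} :=
  GRing.RMorphism.clone _ _ (res h \o comap f V) _.

Definition locally_on_affines
    (P : forall R B : comPzRingType, {rmorphism R -> B} -> Prop)
    (X Y : scheme) (f : mor X Y) : Prop :=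
  forall x : X, exists (U : opens X) (V : opens Y) (h : U `<=` mpre f V),
    [/\ U x, is_affine U, is_affine V & P _ _ (local_map h)].

Definition closed_immersion (X Y : scheme) (i : mor X Y) : Prop :=
  [/\ injective i,
      (forall F : set X, closed F -> closed (i @` F))
      (* surjectivity on stalks *)
    & (forall (W : opens X) (s : sec W) x, W x ->
         exists (U : opens Y) (t : sec U) (V : opens X)
                (h : V `<=` W) (h' : V `<=` mpre i U),
           V x /\ res h s = res h' (comap i U t))].

Definition separated (X Y : scheme) (f : mor X Y) : Prop :=
  forall (Z : scheme) (p q : mor Z X) (d : mor X Z),
    is_pullback p q f f -> mor_comp p d = mor_id X -> mor_comp q d = mor_id X ->
    closed_immersion d.

Definition quasi_compact (X Y : scheme) (f : mor X Y) : Prop :=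
  forall V : opens Y, is_affine V -> compact (mpre f V).

Definition universally_closed (X Y : scheme) (f : mor X Y) : Prop :=
  forall (T Z : scheme) (t : mor T Y) (p : mor Z X) (q : mor Z T),
    is_pullback p q f t -> forall F : set Z, closed F -> closed (q @` F).

Definition is_proper (X Y : scheme) (f : mor X Y) : Prop :=
  [/\ separated f, quasi_compact f, locally_on_affines finite_type f
    & universally_closed f].

Definition smooth (X Y : scheme) (f : mor X Y) : Prop :=
  locally_on_affines
    (fun R B phi => finite_presentation phi /\ formally_smooth phi) f.

(* Projective n-space over Spec R: affine charts U_i, with O(U_i) the polynomial
   algebra on the t i j = x_j / x_i for j <> i, glued along the usual loci. *)
Definition is_projective_space (R : comPzRingType) (S : spec R) (n : nat)
    (Y : scheme) (y : mor Y S) : Prop :=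
  exists (U : 'I_n.+1 -> opens Y) (t : forall i, 'I_n.+1 -> sec (U i)),
    [/\ (forall x, exists i, U i x) /\ (forall i, is_affine (U i)),
        (forall i, t i i = 1),
        (forall i (C : comPzRingType) (psi : {rmorphism R -> C})
                (c : 'I_n.+1 -> C), c i = 1 ->
           exists! h : {rmorphism sec (U i) -> C},
             (forall a, h (scal y (U i) a) = psi a) /\
             (forall j, h (t i j) = c j)),
        (forall i j x, U i x -> (U j x <-> unit_at (t i j) x))
      & (forall i j l (W : opens Y) (hi : W `<=` U i) (hj : W `<=` U j),
           res hi (t i j) * res hj (t j l) = res hi (t i l))].

Definition projective (R : comPzRingType) (S : spec R) (X : scheme)
    (f : mor X S) : Prop :=
  exists n (Y : scheme) (y : mor Y S) (i : mor X Y),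
    [/\ is_projective_space n y, closed_immersion i & mor_comp y i = f].

Definition integral_scheme (X : scheme) : Prop :=
  (opT X : set X) !=set0 /\
  forall U : opens X, U !=set0 ->
    (1 : sec U) <> 0 /\ forall a b : sec U, a * b = 0 -> a = 0 \/ b = 0.

Definition irreducible_closed (X : topologicalType) (Z : set X) : Prop :=
  [/\ closed Z, Z !=set0
    & forall F1 F2 : set X, closed F1 -> closed F2 -> Z `<=` F1 `|` F2 ->
        Z `<=` F1 \/ Z `<=` F2].

Definition one_dimensional (X : topologicalType) : Prop :=
  (exists Z0 Z1 : set X,
     [/\ irreducible_closed Z0, irreducible_closed Z1 & Z0 `<` Z1]) /\
  ~ (exists Z0 Z1 Z2 : set X,
       [/\ irreducible_closed Z0, irreducible_closed Z1, irreducible_closed Z2,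
           Z0 `<` Z1 & Z1 `<` Z2]).

(* The points of a variety over an algebraically closed field, in the classical
   sense: those with residue field k, i.e. the closed points. *)
Definition kpoint (k : comPzRingType) (S : spec k) (X : scheme) (f : mor X S)
    (x : X) : Prop :=
  forall (U : opens X) (s : sec U), U x ->
    exists c : k, ~ unit_at (s - scal f U c) x.

(* The germ of t generates the maximal ideal of the stalk at x. *)
Definition uniformizer (X : scheme) (x : X) (U : opens X) (t : sec U) : Prop :=
  [/\ U x, ~ unit_at t x
    & forall (V : opens X) (s : sec V), V x -> ~ unit_at s x ->
        exists (W : opens X) (h : W `<=` U) (h' : W `<=` V) (r : sec W),
          W x /\ res h' s = res h t * r].

(* The stalks at the closed points have dimension 1, hence are regular if and
   only if their maximal ideal is principal. *)
Definition nonsingular_projective_curve (k : closedFieldType) (S : spec k)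
    (X : scheme) (f : mor X S) : Prop :=
  [/\ integral_scheme X, projective f, one_dimensional X
    & forall x, kpoint f x -> exists (U : opens X) (t : sec U), uniformizer x t].

(* A proper smooth family of curves: proper and smooth, and every geometric
   fibre is a nonsingular projective curve. *)
Definition family_of_curves (X Y : scheme) (f : mor X Y) : Prop :=
  [/\ is_proper f, smooth f
    & forall (k : closedFieldType) (S : spec k) (s : mor S Y) (Z : scheme)
             (p : mor Z X) (q : mor Z S),
        is_pullback p q f s -> nonsingular_projective_curve q].

(* The field k(X) of an integral scheme X, as the colimit of the O_X(U) over the
   nonempty open sets U, i.e. the stalk at the generic point. *)
Record function_field (X : scheme) := FunctionField {
  ff :> fieldType;
  germ : forall U : opens X, U !=set0 -> {rmorphism sec U -> ff};
  germ_res : forall (U V : opens X) (hU : U !=set0) (hV : V !=set0)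
    (h : V `<=` U) s, germ hV (res h s) = germ hU s;
  germ_surj : forall z : ff,
    exists (U : opens X) (hU : U !=set0) (s : sec U), z = germ hU s;
  germ_eq0 : forall (U : opens X) (hU : U !=set0) (s : sec U), germ hU s = 0 ->
    exists (V : opens X) (h : V `<=` U), V !=set0 /\ res h s = 0;
  ff_nonempty : (opT X : set X) !=set0 }.

Arguments germ {_} _ {_} _.

Definition ffconst (k : comPzRingType) (S : spec k) (X : scheme) (f : mor X S)
    (K : function_field X) : {rmorphism k -> K} :=
  GRing.RMorphism.clone _ _ (germ K (ff_nonempty K) \o scal f (opT X)) _.

(* ord_x(z) >= n, that is, z lies in t^n O_x with t a uniformizer at x; in
   particular this holds for z = 0. *)
Definition ord_ge (X : scheme) (K : function_field X) (x : X) (n : int) (z : K)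
    : Prop :=
  exists (U V : opens X) (hU : U !=set0) (hV : V !=set0) (t : sec U) (r : sec V),
    [/\ uniformizer x t, V x & z = germ K hV r * germ K hU t ^ n].

Section CurveInvariants.
Variables (k : closedFieldType) (S : spec k) (X : scheme) (f : mor X S).
Variable K : function_field X.

(* L(D) = {z | div(z) + D >= 0} *)
Definition LD (D : X -> int) : set K :=
  [set z | forall x, kpoint f x -> ord_ge x (- D x) z].

Definition L (P : X) (i : nat) : set K :=
  LD (fun x => if x == P then i%:Z else 0).

Definition lincomb (n : nat) (b : 'I_n -> K) (c : 'rV[k]_n) : K :=
  \sum_(j < n) ffconst f K (c 0 j) * b j.

Definition is_basis (V : set K) (n : nat) (b : 'I_n -> K) : Prop :=
  (forall z, V z <-> exists c, z = lincomb b c) /\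
  (forall c, lincomb b c = 0 -> c = 0).

Definition has_dim (V : set K) (n : nat) : Prop :=
  exists b : 'I_n -> K, is_basis V b.

Definition is_divisor (D : X -> int) : Prop :=
  finite_set [set x | D x != 0] /\ forall x, D x != 0 -> kpoint f x.

Definition deg (D : X -> int) : int := \sum_(x \in [set: X]) D x.

(* Weil's definition: g is the maximum of deg D - dim L(D) + 1 over all D. *)
Definition is_genus (g : nat) : Prop :=
  (forall D, is_divisor D ->
     exists2 l, has_dim (LD D) l & deg D - l%:Z + 1 <= g%:Z) /\
  (exists2 D, is_divisor D &
     exists2 l, has_dim (LD D) l & deg D - l%:Z + 1 = g%:Z).

Definition pole_number (P : X) (i : nat) : Prop :=
  i = 0%N \/ L P i.-1 `<` L P i.

Definition smallest_prime_to_p_pole_number (p : nat) (P : X) (m : nat) : Prop :=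
  [/\ pole_number P m, ~~ (p %| m)%N
    & forall i, pole_number P i -> ~~ (p %| i)%N -> (m <= i)%N].

(* A basis of L(mP) adapted to L(0) <= L(P) <= ... <= L(mP): each L(iP) is
   spanned by an initial segment of it. *)
Definition adapted_basis (P : X) (m n : nat) (b : 'I_n -> K) : Prop :=
  is_basis (L P m) b /\
  forall i, (i <= m)%N -> exists d, forall z,
    L P i z <->
    exists2 c : 'rV[k]_n, (forall j : 'I_n, (d <= j)%N -> c 0 j = 0)
                        & z = lincomb b c.

(* theta : M -> V exhibits V as the base change M (x)_A k along red : A -> k,
   through the universal property of the tensor product. *)
Definition is_base_change (A : comPzRingType) (red : {rmorphism A -> k})
    (M : zmodType) (scale : A -> M -> M) (V : set K) (theta : M -> K) : Prop :=
  [/\ (forall s t, theta (s + t) = theta s + theta t),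
      (forall a s, theta (scale a s) = ffconst f K (red a) * theta s),
      (forall s, V (theta s))
    & forall (W : lmodType k) (u : M -> W),
        (forall s t, u (s + t) = u s + u t) ->
        (forall a s, u (scale a s) = red a *: u s) ->
        let linear_ext (h : K -> W) :=
          [/\ (forall z w, V z -> V w -> h (z + w) = h z + h w),
              (forall c z, V z -> h (ffconst f K c * z) = c *: h z)
            & (forall s, h (theta s) = u s)] in
        (exists h, linear_ext h) /\
        (forall h h', linear_ext h -> linear_ext h' -> {in V, h =1 h'})].

End CurveInvariants.

Arguments LD {k S X} f K D.
Arguments L {k S X} f K P i.

(* z |-> z o a on k(X), for a an automorphism of X. *)
Definition is_pullback_fun (X : scheme) (K : function_field X) (a : mor X X)
    (z w : K) : Prop :=
  exists (U : opens X) (hU : U !=set0) (hU' : mpre a U !=set0) (s : sec U),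
    z = germ K hU s /\ w = germ K hU' (comap a U s).

Record action_over (X Y : scheme) (f : mor X Y) (G : finGroupType) := ActionOver {
  amor :> G -> mor X X;
  amor1 : amor 1%g = mor_id X;
  amorM : forall s t, amor (s * t)%g = mor_comp (amor s) (amor t);
  amor_over : forall s, mor_comp f (amor s) = f }.

Definition stabilizer (X Y : scheme) (f : mor X Y) (G : finGroupType)
    (alpha : action_over f G) (P : X) : {set G} :=
  [set s : G | alpha s P == P]%SET.

Definition stabilizer_ppart (p : nat) (X Y : scheme) (f : mor X Y)
    (G : finGroupType) (alpha : action_over f G) (P : X) : {set G} :=
  [set s in stabilizer alpha P | (p.-elt s)%g]%SET.

Definition wildly_ramified (p : nat) (X Y : scheme) (f : mor X Y)
    (G : finGroupType) (alpha : action_over f G) (P : X) : Prop :=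
  stabilizer_ppart p alpha P != 1%g.

(* A deformation over Spec A of X with its G-action, special being the
   morphism Spec k -> Spec A: the last two conditions say that j induces a
   G-equivariant isomorphism of X with the special fibre. *)
Definition is_deformation (X Xd Sk SA : scheme) (f : mor X Sk) (fd : mor Xd SA)
    (special : mor Sk SA) (G : finGroupType)
    (alpha : action_over f G) (beta : action_over fd G) (j : mor X Xd) : Prop :=
  [/\ family_of_curves fd, is_pullback j f fd special
    & forall s, mor_comp j (alpha s) = mor_comp (beta s) j].

Record omodule (X : scheme) := OModule {
  msec :> forall U : opens X, lmodType (sec U);
  mres : forall U V : opens X, V `<=` U -> msec U -> msec V;
  mresD : forall (U V : opens X) (h : V `<=` U) s t,
    mres h (s + t) = mres h s + mres h t;
  mresZ : forall (U V : opens X) (h : V `<=` U) a s,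
    mres h (a *: s) = res h a *: mres h s;
  mres_id : forall (U : opens X) (h : U `<=` U) s, mres h s = s;
  mres_comp : forall (U V W : opens X)
    (h : V `<=` U) (h' : W `<=` V) (h'' : W `<=` U) s,
    mres h' (mres h s) = mres h'' s;
  msec_sheaf : is_sheaf mres }.

Arguments mres {_ _ U V} _ _.

Definition invertible_module (X : scheme) (M : omodule X) : Prop :=
  forall x : X, exists (U : opens X) (e : M U), U x /\
    forall (V : opens X) (h : V `<=` U),
      bijective (fun a : sec V => a *: mres h e).

(* G-invariance of M: an action of G on the sections of M, s |-> s o sigma,
   lying over the action on X.  It is a right action, like the pullback of
   functions. *)
Record invariant_module (X Y : scheme) (f : mor X Y) (G : finGroupType)
    (beta : action_over f G) (M : omodule X) := InvariantModule {
  eact : forall (s : G) (U : opens X), M U -> M (mpre (beta s) U);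
  eactD : forall s U m n, @eact s U (m + n) = @eact s U m + @eact s U n;
  eactZ : forall s U a m, @eact s U (a *: m) = comap (beta s) U a *: @eact s U m;
  eact_res : forall s (U V : opens X) (h : V `<=` U)
    (h' : mpre (beta s) V `<=` mpre (beta s) U) m,
    @eact s V (mres h m) = mres h' (@eact s U m);
  eact1 : forall (U : opens X) (h : U `<=` mpre (beta 1%g) U) m,
    mres h (@eact 1%g U m) = m;
  eactM : forall s t (U : opens X)
    (h : mpre (beta t) (mpre (beta s) U) `<=` mpre (beta (s * t)%g) U) m,
    mres h (@eact (s * t)%g U m) = @eact t _ (@eact s U m) }.

Definition gsec (X : scheme) (M : omodule X) := M (opT X).

Definition gpull (X Y : scheme) (f : mor X Y) (G : finGroupType)
    (beta : action_over f G) (M : omodule X) (i : invariant_module beta M)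
    (s : G) (m : gsec M) : gsec M :=
  mres (@sub_mpreT X X (beta s) (opT X)) (eact i s m).

Definition gscale (A : comPzRingType) (S : spec A) (X : scheme) (f : mor X S)
    (M : omodule X) (a : A) (m : gsec M) : gsec M :=
  scal f (opT X) a *: (m : M (opT X)).

Definition free_of_finite_rank (A : comPzRingType) (S : spec A) (X : scheme)
    (f : mor X S) (M : omodule X) : Prop :=
  exists r (e : 'I_r -> gsec M), forall m : gsec M,
    exists! a : 'I_r -> A, m = \sum_(j < r) gscale f (a j) (e j).

(* Main.v *)
Require Import Defs.
From HB Require Import structures.
From mathcomp Require Import all_boot all_order all_algebra all_fingroup all_solvable.
From mathcomp Require Import mxrepresentation.
From mathcomp Require Import all_classical.
From mathcomp Require Import topology.

Set Implicit Arguments.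
Unset Strict Implicit.
Unset Printing Implicit Defensive.

Import GRing.Theory.
Local Open Scope classical_set_scope.
Local Open Scope ring_scope.

(** Each L_i is a free A-module whose reduction along A -> k is L(iP).  As A is
local, any family of sections of L_i reducing to a basis of L(iP) is a basis of
L_i ([lift_basis]: the transition matrix to a known basis has a determinant
with nonzero reduction).  The spaces L(iP) grow by at most one dimension at
each step ([L_step]), since subtracting a multiple kills the leading
coefficient at P.  So if L(P) is a line, the L_i contain a complete flag of
G-stable free submodules of L_m.  Lifting each vector of the adapted basis b to
the first L_i in which it appears gives a basis of L_m adapted to this flag
([flag_lift]), in which G acts by lower triangular matrices that reduce to rho.
The diagonal entries are characters of a p-group with values in a domain of
characteristic p (A contains k), where x ^ (p ^ e) = 1 forces x = 1; hence they
are 1 ([trig_pgroup_unitriangular]).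

There remains the case that L(P) is larger than L(0), in which the flag has no
step that lifts L(0).  Then 1 is a pole number prime to p, so m = 1, and L(0)
is the line of constants ([L0_const]: its elements have all their powers in a
finite-dimensional space, so are algebraic over k), so n = 2.  The first
vector of b is lifted by a fixed vector instead: choose a central element s of
order a power of p in G_1(P), s <> 1.  Faithfulness of rho makes the lower left
entry of s - 1 a unit, so the kernel of s - 1 on A^2 is a direct summand of
rank one, stable under the centralizer of s, that is under all of G_1(P)
([lift_trig_pgroup2]). *)

(** * Triangular matrix representations of p-groups in characteristic p *)

Lemma sum_ord2 (V : nmodType) (F : 'I_2 -> V) : \sum_(i < 2) F i = F 0 + F 1.
Proof.
by rewrite !big_ord_recl big_ord0 addr0; congr (_ + F _); apply: val_inj.
Qed.

Lemma row2P (R : Type) (u v : 'rV[R]_2) : u 0 0 = v 0 0 -> u 0 1 = v 0 1 -> u = v.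
Proof.
move=> uv0 uv1; apply/rowP; case=> [[|[|l]] hl] //.
  by rewrite (_ : Ordinal hl = 0) //; apply: val_inj.
by rewrite (_ : Ordinal hl = 1) //; apply: val_inj.
Qed.

Lemma det_mx22 (R : comPzRingType) (B : 'M[R]_2) :
  \det B = B 0 0 * B 1 1 - B 0 1 * B 1 0.
Proof.
rewrite (expand_det_row _ 0) !big_ord_recl big_ord0 addr0 /cofactor !det_mx11.
rewrite !mxE /= expr0 expr1 mul1r mulN1r mulrN.
by congr (B _ _ * B _ _ - B _ _ * B _ _); apply: val_inj.
Qed.

Lemma ord2_lt (i l : 'I_2) : (i < l)%N -> i = 0 /\ l = 1.
Proof.
by case: i l => [[|[|i]] ?] [[|[|l]] ?] //= _; split; apply: val_inj.
Qed.

Lemma expr_sub1_pchar (R : nzRingType) p (x : R) e :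
  p \in [pchar R] -> (x - 1) ^+ (p ^ e) = x ^+ (p ^ e) - 1.
Proof.
move=> chp; elim: e => [|e IHe]; first by rewrite !expr1.
rewrite expnSr !exprM IHe -!(pFrobenius_autE chp) pFrobenius_autB_comm.
  by rewrite pFrobenius_aut1.
exact: commr1.
Qed.

Lemma pchar_root1 (R : idomainType) p (x : R) e :
  p \in [pchar R] -> x ^+ (p ^ e) = 1 -> x = 1.
Proof.
move=> chp x1; apply/eqP; rewrite -subr_eq0.
have /eqP := expr_sub1_pchar x e chp.
by rewrite x1 subrr expf_eq0 => /andP[].
Qed.

Lemma det_sub1_pchar (R : idomainType) p n (T : 'M[R]_n.+1) e :
  p \in [pchar R] -> T ^+ (p ^ e) = 1 -> \det (T - 1%:M) = 0.
Proof.
move=> chp T1; have chM : p \in [pchar 'M[R]_n.+1].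
  exact: (rmorph_pchar (@scalar_mx R n.+1) chp).
have detX (B : 'M[R]_n.+1) i : \det (B ^+ i) = \det B ^+ i.
  by elim: i => [|i IHi]; rewrite ?det1 // !exprS det_mulmx IHi.
have := detX (T - 1) (p ^ e)%N.
rewrite expr_sub1_pchar // T1 subrr det0 => /esym/eqP.
by rewrite expf_eq0 => /andP[_ /eqP].
Qed.

Lemma is_trig_mulmx (R : pzSemiRingType) n (A B : 'M[R]_n) :
  is_trig_mx A -> is_trig_mx B ->
  is_trig_mx (A *m B) /\ forall i, (A *m B) i i = A i i * B i i.
Proof.
move=> /is_trig_mxP tA /is_trig_mxP tB; split=> [|i].
  apply/is_trig_mxP => i j ij; rewrite mxE big1 // => l _.
  case: (ltnP i l) => [il|li]; first by rewrite tA // mul0r.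
  by rewrite tB ?mulr0 // (leq_ltn_trans li).
rewrite mxE (bigD1 i) //= big1 ?addr0 // => l; rewrite neq_ltn.
by case/orP=> h; [rewrite tB ?mulr0 | rewrite tA ?mul0r].
Qed.

(** On the powers of s the i-th diagonal entry is multiplicative, and s has
p-power order. *)
Lemma trig_pgroup_unitriangular (R : idomainType) p (G : finGroupType) n
    (T : G -> 'M[R]_n) :
  p \in [pchar R] -> (p.-group [set: G]%SET)%g ->
  T 1%g = 1%:M -> {morph T : s t / (s * t)%g >-> s *m t} ->
  forall s, is_trig_mx (T s) -> forall i, T s i i = 1.
Proof.
move=> chp pG T1 TM s tS i.
have TX l : is_trig_mx (T (s ^+ l)%g) /\ T (s ^+ l)%g i i = T s i i ^+ l.
  elim: l => [|l [tl El]]; first by rewrite expg0 T1 mxE eqxx scalar_mx_is_trig.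
  rewrite expgS TM exprS -El; have [tM ->] := is_trig_mulmx tS tl.
  by [].
have /p_natP[e oe] : (p.-nat #[s])%g := mem_p_elt pG (finset.in_setT s).
apply: (pchar_root1 (e := e) chp); rewrite -oe -(TX _).2 expg_order T1.
by rewrite mxE eqxx.
Qed.

(** The reduction fixes the line of the first basis vector.  That line lifts to
the kernel of T sg - 1 for a central sg <> 1: this matrix is singular by
[det_sub1_pchar], and its entry (1, 0) is a unit because the reduction of T sg
is unitriangular and is not the identity.  The kernel is then spanned by a
vector (1, q) with q reducing to 0, and it is stable under the centralizer
of sg. *)
Lemma lift_trig_pgroup2 (A : idomainType) (k : fieldType)
    (red : {rmorphism A -> k}) p (G : finGroupType) (H : {group G})
    (T : G -> 'M[A]_2) :
  (forall a : A, (a \is a GRing.unit) = (red a != 0)) ->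
  p \in [pchar A] -> (p.-group [set: G]%SET)%g -> H :!=: 1%g ->
  T 1%g = 1%:M -> {morph T : s t / (s * t)%g >-> s *m t} ->
  (forall s, s \in H -> is_trig_mx (map_mx red (T s))) ->
  (forall s, s \in H -> map_mx red (T s) = 1%:M -> s = 1%g) ->
  exists2 E : 'M[A]_2, E \in unitmx /\ map_mx red E = 1%:M &
    forall s, s \in H -> is_trig_mx (E *m T s *m invmx E).
Proof.
move=> A_local chp pG ntH T1 TM red_trig faithful.
have chk : p \in [pchar k] by apply: (rmorph_pchar red chp).
have pH : (p.-group H)%g by apply: pgroupS pG; apply: finset.subsetT.
have [sg /setIP[sgH /centP sgZ] nt_sg] : exists2 sg, sg \in ('Z(H))%g & sg != 1%g.
  apply/trivgPn; apply: contra ntH => /eqP Z1.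
  by apply/eqP; exact: (trivg_center_pgroup pH Z1).
pose Tk s := map_mx red (T s).
have Tk1 : Tk 1%g = 1%:M by rewrite /Tk T1 map_mx1.
have TkM : {morph Tk : s t / (s * t)%g >-> s *m t}.
  by move=> s t; rewrite /Tk TM map_mxM.
have /p_natP[e oe] : (p.-nat #[sg])%g := mem_p_elt pG (finset.in_setT sg).
pose N := T sg - 1%:M.
have detN : \det N = 0.
  apply: (det_sub1_pchar (e := e) chp); rewrite -oe.
  have TX l : T sg ^+ l = T (sg ^+ l)%g.
    by elim: l => [|l IHl]; rewrite ?expg0 ?T1 // exprS expgS TM IHl.
  by rewrite TX expg_order T1.
pose w := N 1 0; pose u := N 0 0.
have w_unit : w \is a GRing.unit.
  rewrite A_local; apply: contra nt_sg => /eqP w0.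
  apply/eqP/(faithful _ sgH)/matrixP => i l.
  have Tii := trig_pgroup_unitriangular chk pG Tk1 TkM (red_trig _ sgH).
  have [<-|il] := eqVneq i l; first by rewrite Tii mxE eqxx.
  have /is_trig_mxP tr := red_trig _ sgH.
  move: il; rewrite [RHS]mxE neq_ltn => /orP[il|li].
    by rewrite tr // -val_eqE /= ltn_eqF.
  have [-> ->] : i = 1 /\ l = 0.
    by have [] := ord2_lt li.
  by move: w0; rewrite /w /N !mxE rmorphB /= rmorph0 subr0.
(* (1, q) is annihilated by the first column of N, and by the second one since
   N is singular. *)
pose q := - (u / w).
have uE : u = - (q * w) by rewrite mulNr opprK divrK.
have vE : N 0 1 = - (q * N 1 1).
  apply: (mulIr w_unit); move: detN; rewrite det_mx22 -/u -/w uE => /eqP.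
  by rewrite subr_eq0 => /eqP <-; rewrite !mulNr mulrAC.
pose E : 'M[A]_2 := \matrix_(i, l) (if i == l then 1 else if i == 0 then q else 0).
have E00 : E 0 0 = 1 by rewrite mxE.
have E01 : E 0 1 = q by rewrite mxE.
have E10 : E 1 0 = 0 by rewrite mxE.
have E11 : E 1 1 = 1 by rewrite mxE.
have E_unit : E \in unitmx.
  by rewrite unitmxE det_mx22 E00 E01 E10 E11 mul1r mulr0 subr0 unitr1.
(* This makes the base change E reduce to the identity. *)
have red_q : red q = 0.
  have Tii := trig_pgroup_unitriangular chk pG Tk1 TkM (red_trig _ sgH).
  have : red u = 0.
    by have := Tii 0; rewrite /u /N /Tk !mxE rmorphB /= rmorph1 => ->; rewrite subrr.
  by rewrite /q rmorphN rmorphM /= => ->; rewrite mul0r oppr0.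
exists E.
  split=> //; apply/matrixP => i l; rewrite !mxE.
  case: eqP => [_|_]; first by rewrite rmorph1.
  by case: ifP => _; rewrite ?rmorph0 ?red_q.
have ker (a : 'rV[A]_2) : a *m N = 0 -> a = a 0 0 *: row 0 E.
  move=> aN; have : a 0 0 * u + a 0 1 * w = 0.
    by have /rowP/(_ 0) := aN; rewrite mxE sum_ord2 [RHS]mxE.
  rewrite uE mulrN addrC mulrA -mulrBl => /eqP.
  rewrite (mulIr_eq0 _ (mulIr w_unit)) subr_eq0 => /eqP a1.
  by apply: row2P; rewrite !mxE /= ?mulr1.
have eN : row 0 E *m N = 0.
  apply: row2P; rewrite mxE sum_ord2 ![row _ _ _ _]mxE E00 E01 mul1r [RHS]mxE.
    by rewrite -/u -/w uE addNr.
  by rewrite vE addNr.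
move=> s sH; have TN : T s *m N = N *m T s.
  by rewrite /N mulmxBl mulmxBr -!TM (sgZ _ sH) mulmx1 mul1mx.
have rT : row 0 (E *m T s *m invmx E) = (row 0 E *m T s) 0 0 *: row 0 1%:M.
  rewrite !row_mul {1}(ker (row 0 E *m T s)); last first.
    by rewrite -mulmxA TN mulmxA eN mul0mx.
  by rewrite -scalemxAl; congr (_ *: _); rewrite -row_mul mulmxV.
apply/is_trig_mxP => i l il.
have [-> ->] : i = 0 /\ l = 1.
  exact: ord2_lt.
by have /rowP/(_ 1) := rT; rewrite !mxE mulr0.
Qed.

(** * Bases of function spaces and of their free lifts *)

Section LinearCombinations.
Variables (k : closedFieldType) (S : spec k) (X : scheme) (f : mor X S).
Variable K : function_field X.
Implicit Types (V : set K).

Lemma lincombD n (b : 'I_n -> K) c c' :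
  lincomb f b (c + c') = lincomb f b c + lincomb f b c'.
Proof.
by rewrite -big_split; apply: eq_bigr => l _; rewrite mxE rmorphD mulrDl.
Qed.

Lemma lincombZ n (b : 'I_n -> K) a c :
  lincomb f b (a *: c) = ffconst f K a * lincomb f b c.
Proof.
by rewrite mulr_sumr; apply: eq_bigr => l _; rewrite mxE rmorphM mulrA.
Qed.

Lemma lincomb_delta n (b : 'I_n -> K) l : lincomb f b (delta_mx 0 l) = b l.
Proof.
rewrite /lincomb (bigD1 l) // big1 => [|j /negPf jl].
  by rewrite mxE !eqxx rmorph1 mul1r; apply: addr0.
by rewrite mxE jl andbF rmorph0 mul0r.
Qed.

Lemma lincomb0 n (b : 'I_n -> K) : lincomb f b 0 = 0.
Proof. by rewrite -(scale0r (0 : 'rV_n)) lincombZ rmorph0 mul0r. Qed.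

Lemma lincomb_mul n r (b : 'I_n -> K) (c : 'rV[k]_r) (T : 'M[k]_(r, n)) :
  lincomb f b (c *m T) = lincomb f (fun i => lincomb f b (row i T)) c.
Proof.
rewrite mulmx_sum_row.
rewrite (big_morph _ (lincombD b) (lincomb0 b)).
by apply: eq_bigr => l _; rewrite lincombZ.
Qed.

Lemma lincomb_inj V n (b : 'I_n -> K) : is_basis f V b -> injective (lincomb f b).
Proof.
move=> [_ b_free] c c' cc'; apply/eqP; rewrite -subr_eq0; apply/eqP/b_free.
by rewrite -scaleN1r lincombD lincombZ cc' rmorphN1 mulN1r subrr.
Qed.

Lemma basis_in V n (b : 'I_n -> K) l : is_basis f V b -> V (b l).
Proof. by case=> Vb _; apply/Vb; exists (delta_mx 0 l); rewrite lincomb_delta. Qed.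

Lemma basis_neq0 V n (b : 'I_n -> K) l : is_basis f V b -> b l != 0.
Proof.
move=> Vb; apply/eqP; rewrite -(lincomb_delta b l) => /(Vb.2)/rowP/(_ l).
by rewrite !mxE !eqxx => /eqP; rewrite oner_eq0.
Qed.

(** Over a field this gives invertibility of the transition matrix without
knowing beforehand that both bases have the same size. *)
Lemma basis_change V n r (b : 'I_n -> K) (e : 'I_r -> K) (T : 'M[k]_(n, r)) :
  is_basis f V b -> is_basis f V e -> (forall i, b i = lincomb f e (row i T)) ->
  exists T', T *m T' = 1%:M /\ T' *m T = 1%:M.
Proof.
move=> Vb Ve bE.
have eE l : exists c, e l = lincomb f b c by apply: (proj1 (Vb.1 _)); exact: (basis_in l Ve).
have [T' T'E] : exists T' : 'M_(r, n), forall l, e l = lincomb f b (row l T').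
  exists (\matrix_l xget 0 [set c | e l = lincomb f b c]) => l.
  by rewrite rowK; case: (eE l) => c; exact: (@xgetI _ 0 [set c | e l = lincomb f b c] c).
have inv a1 a2 (x : 'I_a1 -> K) (y : 'I_a2 -> K) M1 M2 : is_basis f V x ->
    (forall i, x i = lincomb f y (row i M1)) ->
    (forall i, y i = lincomb f x (row i M2)) -> M1 *m M2 = 1%:M.
  move=> Vx xE yE; apply/row_matrixP => i; apply: (lincomb_inj Vx).
  rewrite row_mul lincomb_mul (_ : (fun j => _) = y); last first.
    by apply/funext => j; rewrite yE.
  by rewrite -xE row1 lincomb_delta.
by exists T'; split; [apply: (inv _ _ b e) | apply: (inv _ _ e b)].
Qed.

End LinearCombinations.

(** Coordinates are row vectors, so that bases can be changed by matrix
products. *)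
Definition free_basis (A : pzRingType) (N : lmodType A) r (e : 'I_r -> N) : Prop :=
  forall v, exists! a : 'rV[A]_r, v = \sum_(i < r) a 0 i *: e i.

Lemma free_basis_crd (A : pzRingType) (N : lmodType A) r (e : 'I_r -> N) :
  free_basis e -> exists crd : N -> 'rV[A]_r,
    (forall x, x = \sum_(i < r) crd x 0 i *: e i) /\
    (forall x (a : 'rV_r), x = \sum_(i < r) a 0 i *: e i -> crd x = a).
Proof.
move=> N_e; have [crd crdP] := choice N_e; exists crd.
by split=> x; have [xE U] := crdP x.
Qed.

Lemma map_row_surj (A B : Type) (phi : A -> B) r (c : 'rV[B]_r) :
  (forall y, exists x, phi x = y) -> exists a, map_mx phi a = c.
Proof.
move=> phi_surj; have [a ca] := choice (fun i => phi_surj (c 0 i)).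
by exists (\row_i a i); apply/rowP => i; rewrite !mxE ca.
Qed.

Section Lifting.
Variables (k : closedFieldType) (S : spec k) (X : scheme) (f : mor X S).
Variable K : function_field X.
Variables (A : idomainType) (red : {rmorphism A -> k}) (N : lmodType A).
Variables (theta : N -> K).
Hypothesis thetaD : forall s t, theta (s + t) = theta s + theta t.
Hypothesis thetaZ : forall a s, theta (a *: s) = ffconst f K (red a) * theta s.

Lemma theta_sum r (e : 'I_r -> N) (a : 'rV[A]_r) :
  theta (\sum_(i < r) a 0 i *: e i) =
  lincomb f (fun i => theta (e i)) (map_mx red a).
Proof.
have theta0 : theta 0 = 0 by rewrite -(scale0r 0) thetaZ !rmorph0 mul0r.
rewrite (big_morph _ thetaD theta0); apply: eq_bigr => i _.
by rewrite thetaZ mxE.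
Qed.

Hypothesis red_surj : forall c, exists a, red a = c.

(** The universal property is used twice.  Its existence part, for the reduced
coordinates on N, gives independence.  Its uniqueness part, for the zero map
into k^n, gives spanning: the cokernel of the matrix of the theta (e i) in the
basis b also extends zero. *)
Lemma base_change_basis (V : set K) n (b : 'I_n -> K) r (e : 'I_r -> N) :
  is_basis f V b -> is_base_change f red (fun a (x : N) => a *: x) V theta ->
  free_basis e -> is_basis f V (fun i => theta (e i)).
Proof.
move=> Vb [_ _ Vtheta univ] N_e.
have [crd [crdE crdU]] := free_basis_crd N_e.
split=> [z|c c0].
  split=> [Vz|[c ->]]; last first.
    have [a ca] := map_row_surj c red_surj.
    by rewrite -ca -theta_sum; apply: Vtheta.
  pose cb (z : K) : 'rV[k]_n := xget 0 [set c | z = lincomb f b c].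
  have cbK y : V y -> y = lincomb f b (cb y).
    by move=> /(Vb.1) [c yE]; exact: (@xgetI _ 0 [set c | y = lincomb f b c] c).
  have cbU c : cb (lincomb f b c) = c.
    by apply: (lincomb_inj Vb); rewrite -cbK //; apply/Vb.1; exists c.
  pose T := \matrix_i cb (theta (e i)).
  have cbT s : cb (theta s) = map_mx red (crd s) *m T.
    rewrite {1}(crdE s) theta_sum -[RHS]cbU lincomb_mul; congr (cb (lincomb _ _ _)).
    by apply/funext => i; rewrite rowK -cbK.
  have [] // := univ 'rV[k]_n (fun=> 0) _ _.
  - by move=> s t; rewrite addr0.
  - by move=> a s; rewrite scaler0.
  move=> _ /(_ (fun z => cb z *m cokermx T) (fun=> 0)) uniq0.
  have /submxP[D cbz] : (cb z <= T)%MS.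
    rewrite submxE; apply/eqP/uniq0; last by rewrite inE.
      split.
      - move=> x y /cbK -> /cbK ->; rewrite -mulmxDl; congr (_ *m _).
        by rewrite -lincombD !cbU.
      - move=> a x /cbK ->; rewrite scalemxAl; congr (_ *m _).
        by rewrite -lincombZ !cbU.
      - by move=> s; rewrite cbT -mulmxA mulmx_coker mulmx0.
    by split=> *; rewrite ?addr0 ?scaler0.
  exists D; rewrite (cbK _ Vz) cbz lincomb_mul; congr (lincomb _ _ _).
  by apply/funext => i; rewrite rowK -cbK.
have [a ca] := map_row_surj c red_surj.
have crdD s t : crd (s + t) = crd s + crd t.
  apply: crdU; rewrite {1}(crdE s) {1}(crdE t) -big_split /=.
  by apply: eq_bigr => i _; rewrite mxE scalerDl.
have crdZ x s : crd (x *: s) = x *: crd s.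
  apply: crdU; rewrite {1}(crdE s) scaler_sumr.
  by apply: eq_bigr => i _; rewrite mxE scalerA.
have [] := univ 'rV[k]_r (fun s => map_mx red (crd s)) _ _.
- by move=> s t; rewrite crdD map_mxD.
- by move=> x s; rewrite crdZ map_mxZ.
move=> [h [_ hZ hs]] _; pose s := \sum_(i < r) a 0 i *: e i.
have s0 : theta s = 0 by rewrite theta_sum ca.
have <- : map_mx red (crd s) = c by rewrite (crdU s a).
have V0 : V (theta s) by [].
by rewrite -hs s0 -[0 in LHS](mul0r (theta s)) -(rmorph0 (ffconst f K)) hZ // scale0r.
Qed.

Hypothesis A_local : forall a : A, (a \is a GRing.unit) = (red a != 0).

(** A form of Nakayama's lemma for free modules: the transition matrix reduces
to an invertible one, so its determinant is a unit of the local ring A. *)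
Lemma lift_basis (V : set K) r (e : 'I_r -> N) n (x : 'I_n -> N) :
  free_basis e -> is_basis f V (fun i => theta (e i)) ->
  is_basis f V (fun i => theta (x i)) -> free_basis x.
Proof.
move=> N_e Ve Vx.
have [crd [crdE crdU]] := free_basis_crd N_e.
pose T := \matrix_i crd (x i).
have [T' [TT' T'T]] : exists T', map_mx red T *m T' = 1%:M /\ T' *m map_mx red T = 1%:M.
  apply: (basis_change Vx Ve) => i; rewrite -map_row rowK -theta_sum.
  by congr theta.
have nr : n = r.
  by apply/eqP; rewrite eqn_leq (mulmx1_min TT') (mulmx1_min T'T).
subst r.
have T_unit : T \in unitmx.
  have [] := mulmx1_unit TT'.
  by rewrite !unitmxE det_map_mx A_local unitfE.
have combE (a : 'rV_n) :
    \sum_(i < n) a 0 i *: x i = \sum_(l < n) (a *m T) 0 l *: e l.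
  under eq_bigr => i _ do rewrite (crdE (x i)) scaler_sumr.
  rewrite exchange_big; apply: eq_bigr => l _ /=.
  rewrite mxE scaler_suml; apply: eq_bigr => i _.
  by rewrite scalerA mxE.
move=> v; exists (crd v *m invmx T); split=> [|a vE].
  by rewrite combE mulmxKV.
by rewrite (crdU v (a *m T)) ?mulmxK // vE combE.
Qed.

End Lifting.

(** * Lifting a complete flag *)

Lemma sum_widen (V : nmodType) d n (h : (d <= n)%N) (F : 'I_n -> V) :
  (forall l : 'I_n, (d <= l)%N -> F l = 0) ->
  \sum_l F l = \sum_(i < d) F (widen_ord h i).
Proof.
move=> F0; rewrite -(big_ord_narrow h) [RHS]big_mkcond; apply: eq_bigr => l _ /=.
by case: ltnP => // /F0.
Qed.

Lemma extend_row (R : nmodType) d n (h : (d <= n)%N) (c : 'rV[R]_d) :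
  exists a : 'rV[R]_n, (forall l : 'I_n, (d <= l)%N -> a 0 l = 0) /\
    (forall i, a 0 (widen_ord h i) = c 0 i).
Proof.
exists (\row_l (if insub (val l) is Some i then c 0 i else 0)); split=> i.
  by move=> di; rewrite mxE insubN // -leqNgt.
by rewrite mxE /= valK.
Qed.

Lemma initial_basis (k : closedFieldType) (S : spec k) (X : scheme)
    (f : mor X S) (K : function_field X) (V W : set K) n (b : 'I_n -> K) d
    (h : (d <= n)%N) :
  is_basis f V b ->
  (forall z, W z <-> exists2 c : 'rV[k]_n,
     (forall l : 'I_n, (d <= l)%N -> c 0 l = 0) & z = lincomb f b c) ->
  is_basis f W (fun l : 'I_d => b (widen_ord h l)).
Proof.
move=> Vb WE.
have narrow (a : 'rV_n) (c : 'rV_d) :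
    (forall l : 'I_n, (d <= l)%N -> a 0 l = 0) ->
    (forall i, a 0 (widen_ord h i) = c 0 i) ->
    lincomb f b a = lincomb f (fun l : 'I_d => b (widen_ord h l)) c.
  move=> a0 ac; rewrite /lincomb (sum_widen h) => [|l /a0 ->].
    by apply: eq_bigr => i _; rewrite ac.
  by rewrite rmorph0 mul0r.
split=> [z|c].
  rewrite WE; split=> [[a a0 ->]|[c ->]].
    exists (\row_i a 0 (widen_ord h i)).
    by apply: narrow => // i; rewrite mxE.
  by have [a [a0 ac]] := extend_row h c; exists a; rewrite ?(narrow a c).
have [a [a0 ac]] := extend_row h c; rewrite -(narrow a) // => /(Vb.2) aE.
by apply/rowP => i; rewrite -ac aE !mxE.
Qed.

Section Flag.
Variables (k : closedFieldType) (S : spec k) (X : scheme) (f : mor X S).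
Variables (K : function_field X) (A : idomainType) (red : {rmorphism A -> k}).
Hypothesis red_surj : forall c, exists a, red a = c.
Hypothesis A_local : forall a : A, (a \is a GRing.unit) = (red a != 0).
Variables (m : nat) (N : nat -> lmodType A) (theta : forall i, N i -> K).
Arguments theta : clear implicits.
Hypothesis thetaD : forall i, (1 <= i <= m)%N ->
  forall x y, theta i (x + y) = theta i x + theta i y.
Hypothesis thetaZ : forall i, (1 <= i <= m)%N ->
  forall a x, theta i (a *: x) = ffconst f K (red a) * theta i x.
Variable V : nat -> set K.
Hypothesis N_free : forall i, (1 <= i <= m)%N -> exists r (e : 'I_r -> N i),
  free_basis e /\ is_basis f (V i) (fun l => theta i (e l)).
Variable inc : forall i, N i -> N i.+1.
Arguments inc : clear implicits.
Hypothesis incD : forall i, (1 <= i < m)%N ->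
  forall x y, inc i (x + y) = inc i x + inc i y.
Hypothesis incZ : forall i, (1 <= i < m)%N ->
  forall a x, inc i (a *: x) = a *: inc i x.
Hypothesis theta_inc : forall i, (1 <= i < m)%N ->
  forall x, theta i.+1 (inc i x) = theta i x.
Variables (G : Type) (act : forall i, G -> N i -> N i).
Arguments act : clear implicits.
Hypothesis incG : forall i, (1 <= i < m)%N ->
  forall s x, inc i (act i s x) = act i.+1 s (inc i x).
Variables (n : nat) (b : 'I_n -> K) (d : nat -> nat).
Hypothesis d0 : d 0 = 0%N.
Hypothesis d_step : forall i, (i < m)%N -> (d i <= d i.+1 <= (d i).+1)%N.
Hypothesis Vb : forall i, (1 <= i <= m)%N -> exists h : (d i <= n)%N,
  is_basis f (V i) (fun l : 'I_(d i) => b (widen_ord h l)).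

Lemma theta_onto i z : (1 <= i <= m)%N -> V i z -> exists x, theta i x = z.
Proof.
move=> im Vz; have [r [e [_ Ve]]] := N_free im.
have [c ->] := (Ve.1 z).1 Vz.
have [a ca] := map_row_surj c red_surj.
exists (\sum_(l < r) a 0 l *: e l).
by rewrite (theta_sum (thetaD im) (thetaZ im)) ca.
Qed.

(** The vectors lifted in N i are pushed to N i.+1 by inc, and at most one new
vector is lifted there.  When there is one, the d i.+1 vectors so far form a
basis of N i.+1 by [lift_basis], so the image of the new vector, which is the
last, is a combination of vectors up to it. *)
Lemma flag_lift i : (i <= m)%N -> exists y : 'I_n -> N i,
  (forall l : 'I_n, (l < d i)%N -> theta i (y l) = b l) /\
  (forall s (l : 'I_n), (l < d i)%N -> exists a : 'rV[A]_n,
     (forall j : 'I_n, (l < j)%N -> a 0 j = 0) /\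
     act i s (y l) = \sum_(j < n) a 0 j *: y j).
Proof.
elim: i => [_|i IHi im].
  by exists (fun=> 0); split=> [l|s l]; rewrite d0.
have [y [y_theta y_act]] := IHi (ltnW im).
have [h Vi1] := Vb (i := i.+1) im.
have lift (l : 'I_n) : exists x : N i.+1,
    ((l < d i)%N -> x = inc i (y l)) /\
    ((d i <= l < d i.+1)%N -> theta i.+1 x = b l).
  case: (ltnP l (d i)) => [ldi|dil]; first by exists (inc i (y l)).
  case: (ltnP l (d i.+1)) => [ld|_]; last by exists 0.
  have Vl : V i.+1 (b l).
    have := basis_in (Ordinal ld) Vi1.
    by congr (V _ (b _)); apply: val_inj.
  by have [x xb] := theta_onto (i := i.+1) im Vl; exists x; split.
have [y' y'P] := choice lift.
have i_gt0 (l : 'I_n) : (l < d i)%N -> (1 <= i < m)%N.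
  by rewrite im andbT; case: (i) d0 => [->|].
have y'_theta (l : 'I_n) : (l < d i.+1)%N -> theta i.+1 (y' l) = b l.
  case: (ltnP l (d i)) => [ldi _|dil ld].
    have i0 := i_gt0 _ ldi.
    by rewrite (proj1 (y'P l)) // theta_inc // y_theta.
  by apply: (proj2 (y'P l)); rewrite dil.
exists y'; split=> // s l ld.
case: (ltnP l (d i)) => [ldi|dil].
  have i0 := i_gt0 _ ldi.
  have [a [a0 aE]] := y_act s l ldi; exists a; split=> //.
  have inc0 : inc i 0 = 0 by rewrite -(scale0r 0) incZ // scale0r.
  rewrite (proj1 (y'P l)) // -incG // aE (big_morph _ (incD i0) inc0).
  apply: eq_bigr => j _; rewrite incZ //.
  case: (leqP j l) => [jl|/a0 ->]; last by rewrite !scale0r.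
  by rewrite (proj1 (y'P j)) // (leq_ltn_trans jl).
(* Here l = d i is the only new index. *)
have [r [e [N_e Ve]]] := N_free (i := i.+1) im.
have y'_free : free_basis (fun j : 'I_(d i.+1) => y' (widen_ord h j)).
  apply: (lift_basis (thetaD (i := i.+1) im) (thetaZ (i := i.+1) im) A_local N_e Ve).
  rewrite (_ : (fun j => _) = fun j => b (widen_ord h j)) //.
  by apply/funext => j; rewrite y'_theta //=.
have [c [cE _]] := y'_free (act i.+1 s (y' l)).
have [a [a0 ac]] := extend_row h c; exists a; split=> [j lj|].
  apply: a0; have /andP[_ le] := d_step im.
  by apply: (leq_trans le); apply: leq_ltn_trans lj.
rewrite (sum_widen h) => [|j /a0 ->]; last by rewrite scale0r.
by rewrite cE; apply: eq_bigr => j _; rewrite ac.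
Qed.
End Flag.

(** With vectors as rows, a right action corresponds to matrix products in the
same order. *)
Lemma action_matrix (A : pzRingType) (N : lmodType A) (G : finGroupType)
    (act : G -> N -> N) n (y : 'I_n -> N) :
  (forall s u v, act s (u + v) = act s u + act s v) ->
  (forall s a v, act s (a *: v) = a *: act s v) ->
  (forall v, act 1%g v = v) ->
  (forall s t v, act (s * t)%g v = act t (act s v)) ->
  free_basis y -> exists T : G -> 'M[A]_n,
    [/\ T 1%g = 1%:M, {morph T : s t / (s * t)%g >-> s *m t}
      & forall s i (a : 'rV[A]_n), 
          act s (y i) = \sum_(j < n) a 0 j *: y j <-> row i (T s) = a].
Proof.
move=> actD actZ act1 actM y_free.
have [crd [crdE crdU]] := free_basis_crd y_free.
exists (fun s => \matrix_i crd (act s (y i))).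
have TE s i : act s (y i) = \sum_j (\matrix_i crd (act s (y i))) i j *: y j.
  by rewrite {1}(crdE (act s (y i))); apply: eq_bigr => j _; rewrite mxE.
split=> [|s t|s i a].
- apply/row_matrixP => i; rewrite rowK act1 row1; apply: crdU.
  rewrite (bigD1 i) // big1 => [|j /negPf ji]; last by rewrite mxE ji andbF scale0r.
  by rewrite mxE !eqxx scale1r; symmetry; apply: addr0.
- apply/row_matrixP => i; rewrite rowK actM row_mul rowK; apply: crdU.
  rewrite {1}(crdE (act s (y i))).
  have act0 : act t 0 = 0 by have := actZ t 0 0; rewrite !scale0r.
  rewrite (big_morph _ (actD t) act0).
  under eq_bigr => j _ do rewrite actZ (TE t) scaler_sumr.
  rewrite exchange_big; apply: eq_bigr => l _ /=.
  rewrite mxE scaler_suml; apply: eq_bigr => j _.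
  by rewrite scalerA.
- by rewrite rowK; split=> [/crdU //|<-]; apply: crdE.
Qed.

(** * Germs in the function field *)

Section FunctionField.
Variables (X : scheme) (K : function_field X).
Implicit Types (U V W : opens X) (x : X) (z w : K).

Lemma common_nbhd x U V : U x -> V x -> exists W, [/\ W x, W `<=` U & W `<=` V].
Proof.
move=> Ux Vx; exists (Opens (openI (carrier_open U) (carrier_open V))).
by split=> // y [].
Qed.

(** The sheaf condition for the empty covering. *)
Lemma sec_empty U : ~ (U !=set0) -> forall s t : sec U, s = t.
Proof.
move=> U0 s t.
have hC (i : False) : (match i with end : opens X) `<=` U by [].
have cov : U `<=` [set x | exists i : False, (match i with end : opens X) x].
  by move=> x Ux; case: U0; exists x.
have [//|u [_ U_uniq]] := @sec_sheaf X False _ U hC cov (fun i => match i with end).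
by rewrite -(U_uniq s) ?(U_uniq t) // => - [].
Qed.

(** On two disjoint open sets, 1 and 0 glue to a section of their union, whose
germ in K would be both 1 and 0. *)
Lemma opens_meet U V : U !=set0 -> V !=set0 ->
  exists W, [/\ W !=set0, W `<=` U & W `<=` V].
Proof.
move=> hU hV; apply: contrapT => noW.
have UV0 W : W `<=` U -> W `<=` V -> ~ (W !=set0) by move=> WU WV hW; apply: noW; exists W.
pose C (i : bool) := if i then U else V.
pose UV := Opens (openU (carrier_open U) (carrier_open V)).
have hC i : C i `<=` UV by case: i => x; [left | right].
have cov : UV `<=` [set x | exists i, C i x].
  by move=> x [?|?]; [exists true | exists false].
pose s i : sec (C i) := if i is true then 1 else 0.
have [|t [tE _]] := @sec_sheaf X bool C UV hC cov s.
  move=> i j W; case: i; case: j => /= hi hj.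
  - by rewrite !rmorph1.
  - exact/sec_empty/UV0.
  - exact/sec_empty/UV0.
  - by rewrite !rmorph0.
have hUV : UV !=set0 by case: hU => x Ux; exists x; left.
have := germ_res K hUV hV (hC false) t.
rewrite -(germ_res K hUV hU (hC true) t) (tE true) (tE false) rmorph0 rmorph1.
by move/esym/eqP; rewrite oner_eq0.
Qed.

Lemma germ_eq U V (hU : U !=set0) (hV : V !=set0) (s : sec U) (t : sec V) :
  germ K hU s = germ K hV t ->
  exists W (h : W `<=` U) (h' : W `<=` V), W !=set0 /\ res h s = res h' t.
Proof.
move=> st; have [W [hW WU WV]] := opens_meet hU hV.
have [|W' [WW' [hW' rE]]] := @germ_eq0 _ K W hW (res WU s - res WV t).
  by rewrite rmorphB (germ_res K hU) (germ_res K hV) st subrr.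
exists W', (subset_trans WW' WU), (subset_trans WW' WV); split=> //.
move: rE; rewrite rmorphB => /eqP; rewrite subr_eq0 => /eqP.
by rewrite (res_comp _ _ (subset_trans WW' WU)) (res_comp _ _ (subset_trans WW' WV)).
Qed.

(** Surjectivity of a ensures that the inverse image of a nonempty open set
on which two representatives of z agree is again nonempty. *)
Lemma pullback_fun_uniq (a : mor X X) z w w' :
  (forall x, exists y, a y = x) ->
  is_pullback_fun a z w -> is_pullback_fun a z w' -> w = w'.
Proof.
move=> a_surj [U [hU [hU' [s [-> ->]]]]] [V [hV [hV' [t [st ->]]]]].
have [W [WU [WV [[x Wx] rE]]]] := germ_eq st.
have hW : mpre a W !=set0 by have [y ay] := a_surj x; exists y; rewrite /= ay.
have pU : mpre a W `<=` mpre a U by move=> y; apply: WU.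
have pV : mpre a W `<=` mpre a V by move=> y; apply: WV.
rewrite -(germ_res K hU' hW pU) -(germ_res K hV' hW pV).
by rewrite -!(comap_res WU) -!(comap_res WV) rE.
Qed.

(** Membership in the local ring of X at x, seen inside K. *)
Definition regular x z := exists U (hU : U !=set0) (s : sec U), U x /\ z = germ K hU s.

Lemma regularD x z w : regular x z -> regular x w -> regular x (z + w).
Proof.
move=> [U [hU [s [Ux ->]]]] [V [hV [t [Vx ->]]]].
have [W [Wx WU WV]] := common_nbhd Ux Vx; have hW : W !=set0 by exists x.
exists W, hW, (res WU s + res WV t); split=> //.
by rewrite rmorphD (germ_res K hU) (germ_res K hV).
Qed.

Lemma regularM x z w : regular x z -> regular x w -> regular x (z * w).
Proof.
move=> [U [hU [s [Ux ->]]]] [V [hV [t [Vx ->]]]].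
have [W [Wx WU WV]] := common_nbhd Ux Vx; have hW : W !=set0 by exists x.
exists W, hW, (res WU s * res WV t); split=> //.
by rewrite rmorphM (germ_res K hU) (germ_res K hV).
Qed.

Lemma regularX x z n : regular x z -> regular x (z ^+ n).
Proof.
move=> z_reg; elim: n => [|n IHn]; last by rewrite exprS; apply: regularM.
by exists (opT X), (ff_nonempty K), 1; rewrite rmorph1.
Qed.

Definition uniformizing x (t : K) := exists U (hU : U !=set0) (s : sec U),
  uniformizer x s /\ t = germ K hU s.

Lemma uniformizing_regular x t : uniformizing x t -> regular x t.
Proof. by move=> [U [hU [s [[Ux _ _] tE]]]]; exists U, hU, s. Qed.

Lemma uniformizing_dvd x t V (hV : V !=set0) (s : sec V) :
  uniformizing x t -> V x -> ~ unit_at s x ->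
  exists2 u, regular x u & germ K hV s = t * u.
Proof.
move=> [U [hU [r [[Ux _ tP] ->]]]] Vx s_x.
have [W [WU [WV [u [Wx sE]]]]] := tP V s Vx s_x.
have hW : W !=set0 by exists x.
exists (germ K hW u); first by exists W, hW, u.
by rewrite -(germ_res K hV hW WV) sE rmorphM (germ_res K hU).
Qed.

Lemma uniformizing_assoc x t t' : uniformizing x t -> uniformizing x t' ->
  exists2 u, regular x u & t = t' * u.
Proof.
move=> [U [hU [s [[Ux s_x _] ->]]]] t'P.
exact: uniformizing_dvd.
Qed.

Lemma ord_geE x n z : ord_ge x n z <->
  exists t r, [/\ uniformizing x t, regular x r & z = r * t ^ n].
Proof.
split=> [[U [V [hU [hV [t [r [tP Vx ->]]]]]]]|].
  by exists (germ K hU t), (germ K hV r); split=> //; [exists U, hU, t | exists V, hV, r].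
move=> [_ [_ [[U [hU [s [sP ->]]]] [V [hV [r [Vx ->]]]] ->]]].
by exists U, V, hU, hV, s, r.
Qed.

Lemma ord_ge0 x z : ord_ge x 0 z <-> (exists t, uniformizing x t) /\ regular x z.
Proof.
rewrite ord_geE; split=> [[t [r [tP rP ->]]]|[[t tP] zP]].
  by rewrite expr0z mulr1; split=> //; exists t.
by exists t, z; rewrite expr0z mulr1.
Qed.
End FunctionField.

(** * The spaces L(iP) *)

Section Curve.
Variables (k : closedFieldType) (S : spec k) (X : scheme) (f : mor X S).
Variable K : function_field X.
Implicit Types (x P : X) (z w : K).

Lemma germ_scal (U : opens X) (hU : U !=set0) c :
  germ K hU (scal f U c) = ffconst f K c.
Proof.
have UT : U `<=` opT X by [].
rewrite -[RHS]/(germ K (ff_nonempty K) (scal f (opT X) c)).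
rewrite -(germ_res K (ff_nonempty K) hU UT); apply: (congr1 (germ K hU)).
rewrite /scal /= (res_comp _ _ (@sub_mpreT X S f U)); exact: erefl.
Qed.

Lemma regular_const x c : regular x (ffconst f K c).
Proof. by exists (opT X), (ff_nonempty K), (scal f (opT X) c). Qed.

Lemma regular_comb x z w c c' : regular x z -> regular x w ->
  regular x (ffconst f K c * z + ffconst f K c' * w).
Proof. by move=> zx wx; apply: regularD; apply: regularM => //; apply: regular_const. Qed.

(** The residue field at a closed point is k. *)
Lemma kpoint_taylor x t z : kpoint f x -> uniformizing x t -> regular x z ->
  exists c u, regular x u /\ z = ffconst f K c + t * u.
Proof.
move=> kx tx [U [hU [s [Ux ->]]]]; have [c s_x] := kx U s Ux.
have [u ux sE] := uniformizing_dvd hU tx Ux s_x.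
by exists c, u; rewrite -sE rmorphB germ_scal addrC subrK.
Qed.

(** The germ of the chosen uniformizer t may replace the one implicit in
[ord_ge], up to a power of their ratio.  A zero germ is harmless here because
its inverse powers are 0. *)
Lemma ord_ge_pole x n t z : uniformizing x t -> ord_ge x (- n.+1%:Z) z ->
  exists2 r, regular x r & z = r * t ^- n.+1.
Proof.
move=> tx /ord_geE[t' [r [t'x rx ->]]]; rewrite -exprnN.
have [t'0|t'n0] := eqVneq t' 0.
  exists 0; first by rewrite -(rmorph0 (ffconst f K)); apply: regular_const.
  by rewrite t'0 expr0n invr0 mulr0 mul0r.
have [u ux tE] := uniformizing_assoc tx t'x.
have [u' _ t'E] := uniformizing_assoc t'x tx.
have tn0 : t != 0 by apply: contra t'n0 => /eqP t0; rewrite t'E t0 mul0r.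
exists (r * u ^+ n.+1); first by apply: regularM => //; apply: regularX.
rewrite -mulrA; congr (_ * _); rewrite [in RHS]tE exprMn invfM mulrCA divff ?mulr1 //.
by rewrite expf_eq0 /=; apply: contra tn0 => /eqP u0; rewrite tE u0 mulr0.
Qed.

Lemma LP_ord P i z : kpoint f P -> L f K P i z <->
  ord_ge P (- i%:Z) z /\ (forall x, kpoint f x -> x != P -> ord_ge x 0 z).
Proof.
move=> kP; split=> [Lz|[zP zx] x kx]; last first.
  by case: (eqVneq x P) => [->|xP] //; rewrite oppr0; apply: zx.
split; first by have := Lz P kP; rewrite eqxx.
by move=> x kx xP; have := Lz x kx; rewrite (negPf xP) oppr0.
Qed.

Lemma ord_ge0_comb x z w c c' : ord_ge x 0 z -> ord_ge x 0 w ->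
  ord_ge x 0 (ffconst f K c * z + ffconst f K c' * w).
Proof.
move=> /ord_ge0[tx zx] /ord_ge0[_ wx]; apply/ord_ge0; split=> //.
exact: regular_comb.
Qed.

(** A suitable combination of two functions with a pole of order at most i.+1
has no term of that order at P, so L(iP) has codimension at most one in
L((i+1)P). *)
Lemma L_step P i z w : kpoint f P -> L f K P i.+1 z -> L f K P i.+1 w ->
  exists c c', (c != 0) || (c' != 0) /\
    L f K P i (ffconst f K c * z + ffconst f K c' * w).
Proof.
move=> kP /(LP_ord _ _ kP)[zP zx] /(LP_ord _ _ kP)[wP wx].
have /ord_geE[t [_ [tP _ _]]] := zP.
have [r rP zE] := ord_ge_pole tP zP; have [r' r'P wE] := ord_ge_pole tP wP.
have [c0 [s [sP rE]]] := kpoint_taylor kP tP rP.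
have [c1 [s' [s'P r'E]]] := kpoint_taylor kP tP r'P.
have [c [c' [cc' comb0]]] : exists c c', (c != 0) || (c' != 0) /\ c * c0 + c' * c1 = 0.
  have [->|c0n0] := eqVneq c0 0.
    by exists 1, 0; rewrite oner_eq0 mulr0 mul0r addr0.
  by exists c1, (- c0); rewrite oppr_eq0 c0n0 orbT mulNr mulrC subrr.
exists c, c'; split=> //; apply/(LP_ord _ _ kP); split; last first.
  by move=> x kx xP; apply: ord_ge0_comb; [apply: zx | apply: wx].
apply/ord_geE; set phi := ffconst f K.
have E : phi c * z + phi c' * w = t * (phi c * s + phi c' * s') * t ^- i.+1.
  rewrite zE wE !mulrA -mulrDl; congr (_ * _); rewrite rE r'E.
  rewrite !mulrDr addrACA -!rmorphM -rmorphD comb0 rmorph0 add0r.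
  by congr (_ + _); rewrite mulrCA.
have [t0|tn0] := eqVneq t 0.
  exists t, (phi 0); split=> //; first exact: regular_const.
  by rewrite E t0 rmorph0 !mul0r.
exists t, (phi c * s + phi c' * s'); split=> //; first exact: regular_comb.
rewrite E -exprnN exprS invfM [t * _]mulrC -mulrA; congr (_ * _).
by rewrite mulrA divff // mul1r.
Qed.

(** t * t ^- i.+2 = t ^- i.+1 holds even if t = 0.  The inclusion of L(0) in L(P)
needs t <> 0, see [L0_sub_L1]. *)
Lemma L_mono P i z : kpoint f P -> L f K P i.+1 z -> L f K P i.+2 z.
Proof.
move=> kP /(LP_ord _ _ kP)[/ord_geE[t [r [tP rP ->]]] zx].
apply/(LP_ord _ _ kP); split=> //; apply/ord_geE; exists t, (r * t); split=> //.
  by apply: regularM => //; apply: uniformizing_regular.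
rewrite -!exprnN -mulrA; congr (_ * _).
have [->|tn0] := eqVneq t 0; first by rewrite !expr0n invr0 mulr0.
by rewrite [in RHS]exprS invfM mulrA divff // mul1r.
Qed.

(** The nonzero element w of L(P) rules out that a uniformizer at P has germ 0
in K, in which case L(P) would vanish. *)
Lemma L0_sub_L1 P z w : kpoint f P -> L f K P 1 w -> w != 0 ->
  L f K P 0 z -> L f K P 1 z.
Proof.
move=> kP /(LP_ord _ _ kP)[/ord_geE[t [r [tP rP wE]]] _] wn0.
move=> /(LP_ord _ _ kP)[]; rewrite oppr0 => /ord_ge0[_ zP] zx.
apply/(LP_ord _ _ kP); split=> //; apply/ord_geE; exists t, (z * t); split=> //.
  by apply: regularM => //; apply: uniformizing_regular.
have tn0 : t != 0.
  apply: contra wn0 => /eqP t0; rewrite wE t0 -exprnN expr1 invr0 mulr0.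
  exact: eqxx.
by rewrite -exprnN expr1 mulfK.
Qed.

Lemma L0X P z i : kpoint f P -> L f K P 0 z -> L f K P 0 (z ^+ i).
Proof.
move=> kP /(LP_ord _ _ kP)[]; rewrite oppr0 => /ord_ge0[tP zP] zx.
apply/(LP_ord _ _ kP); rewrite oppr0; split=> [|x kx /(zx _ kx)/ord_ge0[tx zx']].
  by apply/ord_ge0; split=> //; apply: regularX.
by apply/ord_ge0; split=> //; apply: regularX.
Qed.

Lemma algebraic_const z (q : {poly k}) : q != 0 ->
  (map_poly (ffconst f K) q).[z] = 0 -> exists c, z = ffconst f K c.
Proof.
move=> qn0; have [r qE] := closed_field_poly_normal q.
rewrite qE map_polyZ hornerZ => /eqP; rewrite mulf_eq0 fmorph_eq0 lead_coef_eq0.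
rewrite (negPf qn0) /= rmorph_prod horner_prod prodf_seq_eq0 => /hasP[c _].
by rewrite /= map_polyXsubC hornerXsubC subr_eq0 => /eqP ->; exists c.
Qed.

(** L(0) is stable under powers and has a finite
basis, so z satisfies a polynomial equation over the algebraically closed
field k. *)
Lemma L0_const P n (b : 'I_n -> K) z : kpoint f P ->
  is_basis f (L f K P 0) b -> L f K P 0 z -> exists c, z = ffconst f K c.
Proof.
move=> kP [L0b _] Lz.
(* The n + 1 powers 1, z, .., z ^ n are dependent. *)
have [c cE] := choice (fun i : 'I_n.+1 => (L0b _).1 (L0X i kP Lz)).
pose C := \matrix_i c i.
have kerC : kermx C != 0.
  by rewrite -mxrank_eq0 mxrank_ker -lt0n subn_gt0 ltnS rank_leq_col.
have /rowV0Pn[v vC vn0] := kerC.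
apply: (@algebraic_const z (rVpoly v)).
  by apply: contra vn0 => /eqP v0; rewrite -(rVpolyK v) v0 linear0.
rewrite -(lincomb0 f b) -(sub_kermxP vC).
rewrite lincomb_mul (@horner_coef_wide _ n.+1); last first.
  by rewrite size_map_poly size_poly.
by apply: eq_bigr => i _; rewrite coef_map /= coef_rVpoly_ord rowK -cE.
Qed.

Lemma L0_basis_size P n (b : 'I_n -> K) : kpoint f P ->
  is_basis f (L f K P 0) b -> (n <= 1)%N.
Proof.
move=> kP L0b; case: n b L0b => [|[|n]] b L0b //.
have [c0 b0E] := L0_const kP L0b (basis_in 0 L0b).
have [c1 b1E] := L0_const kP L0b (basis_in 1 L0b).
have : c1 *: delta_mx 0 0 = c0 *: delta_mx 0 1 :> 'rV_n.+2.
  by apply: (lincomb_inj L0b); rewrite !lincombZ !lincomb_delta b0E b1E mulrC.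
move/rowP/(_ 1); rewrite !mxE /= mulr0 mulr1 => c00.
by have := basis_neq0 0 L0b; rewrite b0E -c00 rmorph0 eqxx.
Qed.

(** D i is the dimension of L(iP).  [adapted_basis] gives it only as some bound,
which may exceed n. *)
Lemma adapted_flag P m n (b : 'I_n -> K) : kpoint f P -> adapted_basis f P m b ->
  exists D : nat -> nat,
    [/\ D m = n,
        forall i, (i <= m)%N -> forall l, L f K P i (b l) <-> (l < D i)%N,
        forall i, (i <= m)%N -> exists h : (D i <= n)%N,
          is_basis f (L f K P i) (fun l : 'I_(D i) => b (widen_ord h l)),
        forall i, (i < m)%N -> (D i.+1 <= (D i).+1)%N
      & forall i, (1 <= i < m)%N -> (D i <= D i.+1)%N].
Proof.
move=> kP [b_basis b_flag]; have b_inj := lincomb_inj b_basis.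
have [D DP] : exists D : nat -> nat, forall i, (i <= m)%N -> (D i <= n)%N /\
    forall z, L f K P i z <-> exists2 c : 'rV[k]_n,
      (forall l : 'I_n, (D i <= l)%N -> c 0 l = 0) & z = lincomb f b c.
  have ex i : exists d, (i <= m)%N -> (d <= n)%N /\
      forall z, L f K P i z <-> exists2 c : 'rV[k]_n,
        (forall l : 'I_n, (d <= l)%N -> c 0 l = 0) & z = lincomb f b c.
    have [im|] := boolP (i <= m)%N; last by exists 0%N.
    have [d dP] := b_flag i im; exists (minn d n) => _; split; first exact: geq_minr.
    move=> z; rewrite dP; split=> -[c c0 ->]; exists c => // l.
      by rewrite geq_min [(n <= l)%N]leqNgt ltn_ord orbF; apply: c0.
    by move=> dl; apply: c0; rewrite geq_min dl.
  by have [D DP] := choice ex; exists D.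
have in_L i c : (i <= m)%N -> L f K P i (lincomb f b c) ->
    forall l : 'I_n, (D i <= l)%N -> c 0 l = 0.
  by move=> im /((DP i im).2 _)[c' c'0 /b_inj ->].
have bD i : (i <= m)%N -> forall l, L f K P i (b l) <-> (l < D i)%N.
  move=> im l; split=> [|lD].
    rewrite -(lincomb_delta f b l) ltnNge => /(in_L _ _ im) c0.
    by apply/negP => /c0; rewrite mxE !eqxx => /eqP; rewrite oner_eq0.
  apply/((DP i im).2 _); exists (delta_mx 0 l); last by rewrite lincomb_delta.
  move=> j Dj; rewrite mxE; case: eqP => //= _; case: eqP => // jl.
  by move: lD; rewrite -jl ltnNge Dj.
exists D; split=> //.
- have [Dn _] := DP m (leqnn m); apply/eqP; rewrite eqn_leq Dn leqNgt.
  apply/negP => Dlt; have := basis_in (Ordinal Dlt) b_basis.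
  by move/(bD m (leqnn m)); rewrite /= ltnn.
- by move=> i im; have [h Li] := DP i im; exists h; apply: (initial_basis h b_basis).
(* With two more vectors l0 and l1 of the basis in L((i+1)P), a nontrivial
   combination of them would lie in L(iP). *)
- move=> i im; rewrite leqNgt; apply/negP => lt.
  have [Dn _] := DP i.+1 im.
  have h1 : ((D i).+1 < n)%N := leq_trans lt Dn.
  pose l0 : 'I_n := Ordinal (ltnW h1); pose l1 : 'I_n := Ordinal h1.
  have L0 : L f K P i.+1 (b l0) by apply/bD => //; apply: ltnW.
  have L1 : L f K P i.+1 (b l1) by apply/bD.
  have [c [c' [cc' Lc]]] := L_step kP L0 L1.
  move: Lc; rewrite -(lincomb_delta f b l0) -(lincomb_delta f b l1).
  rewrite -!lincombZ -lincombD => /(in_L _ _ (ltnW im)) c0.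
  have l01 : (l0 == l1) = false by rewrite -val_eqE /= ltn_eqF.
  have l10 : (l1 == l0) = false by rewrite eq_sym.
  have := c0 l0 (leqnn _); have := c0 l1 (leqnSn _).
  rewrite !mxE !eqxx l01 l10 !mulr0 !mulr1 add0r addr0 => c'0 cc0.
  by move: cc'; rewrite c'0 cc0 eqxx.
- case=> // i /andP[_ im]; rewrite leqNgt; apply/negP => lt.
  have [Dn _] := DP i.+1 (ltnW im).
  pose l : 'I_n := Ordinal (leq_trans lt Dn).
  have : L f K P i.+1 (b l) by apply/bD => //; apply: ltnW.
  by move/(L_mono kP)/(bD _ im); rewrite ltnn.
Qed.
End Curve.

(** * Global sections and group actions *)

(** The global sections of M as a module over A, not over the ring of global
functions; f is an argument because it determines the scalar action. *)
Definition sections (A : comPzRingType) (S : spec A) (X : scheme) (f : mor X S)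
  (M : omodule X) : Type := gsec M.

Section Sections.
Variables (A : comPzRingType) (S : spec A) (X : scheme) (f : mor X S).
Variable M : omodule X.
Local Notation N := (sections f M).

HB.instance Definition _ := GRing.Zmodule.on N.

Fact gscaleA a b (v : N) :
  gscale f a (gscale f b v : gsec M) = gscale f (a * b) v :> N.
Proof. by rewrite /gscale scalerA -rmorphM. Qed.

Fact gscale1 (v : N) : gscale f 1 v = v :> N.
Proof. by rewrite /gscale rmorph1 scale1r. Qed.

Fact gscaleDr (a : A) (u v : N) :
  gscale f a (u + v : N) = (gscale f a u : N) + (gscale f a v : N) :> N.
Proof. exact: scalerDr. Qed.

Fact gscaleDl (v : N) a b :
  gscale f (a + b) v = (gscale f a v : N) + (gscale f b v : N) :> N.
Proof. by rewrite /gscale rmorphD scalerDl. Qed.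

HB.instance Definition _ := GRing.Zmodule_isLmodule.Build A N
  gscaleA gscale1 gscaleDr gscaleDl.

Lemma free_of_finite_rank_basis :
  free_of_finite_rank f M -> exists r (e : 'I_r -> N), free_basis e.
Proof.
move=> [r [e eP]]; exists r, e => v; have [a [vE U]] := eP v.
exists (\row_i a i); split=> [|c cE].
  by rewrite [LHS]vE; apply: eq_bigr => i _; rewrite mxE.
by apply/rowP => i; rewrite mxE (U (fun i => c 0 i)).
Qed.

End Sections.

Section GroupAction.
Variables (R : comPzRingType) (S : spec R) (X : scheme) (f : mor X S).

Lemma comap_scal (a : mor X X) c : mor_comp f a = f ->
  res (@sub_mpreT X X a (opT X)) (comap a (opT X) (scal f (opT X) c)) =
  scal f (opT X) c.
Proof.
move=> fa; rewrite -[in RHS]fa /scal /=.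
have h : mpre a (opT X) `<=` mpre a (mpre f (opT S)) by [].
have h' : opT X `<=` mpre a (mpre f (opT S)) by [].
rewrite (comap_res (@sub_mpreT X S f (opT X)) h) !(res_comp _ _ h').
by [].
Qed.

Variables (G : finGroupType) (alpha : action_over f G).

Lemma action_fn1 x : alpha 1%g x = x.
Proof. by rewrite amor1. Qed.

Lemma action_fnM s t x : alpha (s * t)%g x = alpha s (alpha t x).
Proof. by rewrite amorM. Qed.

Lemma action_surj s x : exists y, alpha s y = x.
Proof. by exists (alpha s^-1%g x); rewrite -action_fnM mulgV action_fn1. Qed.

Lemma stabilizer_group_set P : group_set (stabilizer alpha P).
Proof.
apply/group_setP; split=> [|s t]; rewrite !inE ?action_fn1 //.
by move=> /eqP sP /eqP tP; rewrite action_fnM tP sP.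
Qed.

(** All elements of a p-group are p-elements, hence G_1(P) = G_0(P) is a group. *)
Lemma stabilizer_ppartE (p : nat) P : (p.-group [set: G]%SET)%g ->
  stabilizer_ppart p alpha P = stabilizer alpha P.
Proof.
move=> pG; apply/setP => s; rewrite !inE andb_idr // => _.
exact: mem_p_elt pG (finset.in_setT s).
Qed.

Variables (M : omodule X) (i : invariant_module alpha M).

Lemma gpullD s x y : gpull i s (x + y) = gpull i s x + gpull i s y.
Proof. by rewrite /gpull eactD mresD. Qed.

Lemma gpullZ s a x : gpull i s (gscale f a x) = gscale f a (gpull i s x).
Proof. by rewrite /gpull /gscale eactZ mresZ comap_scal ?amor_over. Qed.

Lemma gpull1 x : gpull i 1%g x = x.
Proof. exact: eact1. Qed.

Lemma gpullM s t x : gpull i (s * t)%g x = gpull i t (gpull i s x).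
Proof.
rewrite /gpull.
have h1 : mpre (alpha t) (opT X) `<=` mpre (alpha t) (mpre (alpha s) (opT X)) by [].
have h2 : mpre (alpha t) (mpre (alpha s) (opT X)) `<=` mpre (alpha (s * t)%g) (opT X) by [].
have h3 : opT X `<=` mpre (alpha t) (mpre (alpha s) (opT X)) by [].
rewrite (eact_res i (@sub_mpreT X X (alpha s) (opT X)) h1) (mres_comp _ _ h3) -(eactM i h2).
by rewrite (mres_comp _ _ (@sub_mpreT X X (alpha (s * t)%g) (opT X))).
Qed.

End GroupAction.

Lemma pullback_const (k : closedFieldType) (S : spec k) (X : scheme)
    (f : mor X S) (K : function_field X) (a : mor X X) c :
  mor_comp f a = f -> is_pullback_fun a (ffconst f K c) (ffconst f K c).
Proof.
move=> fa; have hT := ff_nonempty K; have hT' : mpre a (opT X) !=set0 := hT.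
exists (opT X), hT, hT', (scal f (opT X) c); split; first by rewrite germ_scal.
by rewrite -(germ_res K hT' hT (@sub_mpreT X X a (opT X))) comap_scal // germ_scal.
Qed.

Theorem proposition3p1
  (* the curve X over k, its function field K, its genus g *)
  (p : nat) (p_prime : prime p)
  (k : closedFieldType) (k_char : p \in [pchar k]) (Sk : spec k)
  (X : scheme) (f : mor X Sk) (X_curve : nonsingular_projective_curve f)
  (K : function_field X) (g : nat) (X_genus : is_genus f K g) (g_ge2 : (2 <= g)%N)
  (* the p-group G of automorphisms of X *)
  (G : finGroupType) (G_pgroup : (p.-group [set: G]%SET)%g)
  (alpha : action_over f G) (alpha_inj : injective (amor alpha))
  (* the local integral domain A, a k-algebra with residue field k *)
  (A : idomainType) (iota : {rmorphism k -> A}) (red : {rmorphism A -> k})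
  (red_iota : forall c, red (iota c) = c)
  (A_local : forall a : A, (a \is a GRing.unit) = (red a != 0))
  (* the deformation Xd -> Spec A of (X, G) *)
  (SA : spec A) (special : mor Sk SA) (special_red : is_spec_map red special)
  (Xd : scheme) (fd : mor Xd SA) (beta : action_over fd G) (j : mor X Xd)
  (Xd_deformation : is_deformation special alpha beta j)
  (* the wildly ramified point P *)
  (P : X) (P_point : kpoint f P) (P_wild : wildly_ramified p alpha P)
  (m : nat) (m_pole : smallest_prime_to_p_pole_number f K p P m)
  (m_le : (m <= 2 * g - 1)%N)
  (* the faithful representation rho in an adapted basis b of L(mP) *)
  (n : nat) (b : 'I_n -> K) (b_adapted : adapted_basis f P m b)
  (rho : G -> 'M[k]_n)
  (rho_action : forall s, s \in stabilizer_ppart p alpha P -> forall i,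
     is_pullback_fun (alpha s) (b i) (\sum_(l < n) ffconst f K (rho s i l) * b l))
  (rho_faithful : forall s, s \in stabilizer_ppart p alpha P ->
     rho s = 1%:M -> s = 1%g)
  (* the G-invariant invertible modules M i, for 1 <= i <= m *)
  (M : nat -> omodule Xd)
  (M_invertible : forall i, (1 <= i <= m)%N -> invertible_module (M i))
  (M_inv : forall i, invariant_module beta (M i))
  (* the inclusions of A[G]-modules L_i -> L_(i+1) *)
  (inc : forall i, gsec (M i) -> gsec (M i.+1))
  (inc_inj : forall i, (1 <= i < m)%N -> injective (@inc i))
  (incD : forall i, (1 <= i < m)%N ->
     forall x y, inc i (x + y) = inc i x + inc i y)
  (incZ : forall i, (1 <= i < m)%N ->
     forall a x, inc i (gscale fd a x) = gscale fd a (inc i x))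
  (incG : forall i, (1 <= i < m)%N ->
     forall s x, inc i (gpull (M_inv i) s x) = gpull (M_inv i.+1) s (inc i x))
  (L_free : forall i, (1 <= i <= m)%N -> free_of_finite_rank fd (M i))
  (* the identifications L_i (x)_A k = L(iP), compatible with the inclusions
     and with the action of G_1(P) *)
  (theta : forall i, gsec (M i) -> K)
  (theta_base_change : forall i, (1 <= i <= m)%N ->
     is_base_change f red (@gscale A SA Xd fd (M i)) (L f K P i) (theta i))
  (theta_inc : forall i, (1 <= i < m)%N ->
     forall x, theta i.+1 (inc i x) = theta i x)
  (thetaG : forall i, (1 <= i <= m)%N ->
     forall s, s \in stabilizer_ppart p alpha P ->
     forall x, is_pullback_fun (alpha s) (theta i x) (theta i (gpull (M_inv i) s x))) :
  exists rho1 : G -> 'M[A]_n,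
    [/\ mx_repr (stabilizer_ppart p alpha P) rho1,
        (forall s, s \in stabilizer_ppart p alpha P -> rho1 s \in unitmx),
        (forall s, s \in stabilizer_ppart p alpha P ->
           map_mx red (rho1 s) = rho s)
      & (forall s, s \in stabilizer_ppart p alpha P ->
           is_trig_mx (rho1 s) /\ forall i, rho1 s i i = 1)].
Proof.
set H := stabilizer_ppart p alpha P in rho_action rho_faithful thetaG *.
have m_gt0 : (0 < m)%N.
  by case: m_pole => _ pm _; move: pm; case: (m) => //; rewrite dvdn0.
have red_surj c : exists a, red a = c by exists (iota c).
have chA : p \in [pchar A] by apply: (rmorph_pchar iota k_char).
have alpha_f s : mor_comp f (alpha s) = f by apply: amor_over.
have uniq_pull s z w w' : is_pullback_fun (alpha s) z w ->
    is_pullback_fun (alpha s) z w' -> w = w'.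
  exact/pullback_fun_uniq/action_surj.
have b_basis := b_adapted.1; have b_inj := lincomb_inj b_basis.
have [D [Dm bD VB D_succ D_mono]] := adapted_flag P_point b_adapted.
pose N i : lmodType A := sections fd (M i).
pose th i : N i -> K := @theta i.
pose act i s (x : N i) : N i := gpull (M_inv i) s x.
have thD i : (1 <= i <= m)%N -> forall x y, th i (x + y) = th i x + th i y.
  by case/theta_base_change.
have thZ i : (1 <= i <= m)%N ->
    forall a x, th i (a *: x) = ffconst f K (red a) * th i x.
  by case/theta_base_change.
have N_free i : (1 <= i <= m)%N -> exists r (e : 'I_r -> N i),
    free_basis e /\ is_basis f (L f K P i) (fun l => th i (e l)).
  move=> im; have [r [e e_free]] := free_of_finite_rank_basis (L_free i im).
  exists r, e; split=> //; have /andP[_ im'] := im.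
  have [h Vb] := VB i im'.
  exact: (base_change_basis (thD i im) (thZ i im) red_surj Vb (theta_base_change i im)).
have mm : (1 <= m <= m)%N by rewrite m_gt0 leqnn.
have actD s u v : act m s (u + v) = act m s u + act m s v by apply: gpullD.
have actZ s a v : act m s (a *: v) = a *: act m s v by apply: gpullZ.
have act1 v : act m 1%g v = v by apply: gpull1.
have actM s t v : act m (s * t)%g v = act m t (act m s v) by apply: gpullM.
have y_basis (y : 'I_n -> N m) : (forall l, th m (y l) = b l) -> free_basis y.
  move=> yb; have [r [e [e_free Ve]]] := N_free m mm.
  apply: (lift_basis (thD m mm) (thZ m mm) A_local e_free Ve).
  by rewrite (_ : (fun i => _) = b) //; apply/funext.
have red_T (y : 'I_n -> N m) (T : G -> 'M[A]_n) :
    (forall l, th m (y l) = b l) ->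
    (forall s i (a : 'rV[A]_n),
       act m s (y i) = \sum_(j < n) a 0 j *: y j <-> row i (T s) = a) ->
    forall s, s \in H -> map_mx red (T s) = rho s.
  move=> yb TE s sH; apply/row_matrixP => i; apply: b_inj.
  have : is_pullback_fun (alpha s) (th m (y i)) (th m (act m s (y i))).
    exact: thetaG.
  rewrite yb ((TE s i _).2 erefl).
  rewrite (theta_sum (thD m mm) (thZ m mm)) map_row.
  rewrite (_ : (fun i => _) = b); last exact/funext.
  move=> pull; apply: (uniq_pull K s _ _ _ pull).
  have := rho_action s sH i; congr is_pullback_fun.
  by apply: eq_bigr => l _; rewrite mxE.
suff [rho1 [rho1_1 rho1_M rho1_red rho1_trig]] : exists rho1 : G -> 'M[A]_n,
    [/\ rho1 1%g = 1%:M, {morph rho1 : s t / (s * t)%g >-> s *m t},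
        forall s, s \in H -> map_mx red (rho1 s) = rho s
      & forall s, s \in H -> is_trig_mx (rho1 s)].
  exists rho1; split=> // [|s sH|s sH].
  - by split=> // s t _ _; apply: rho1_M.
  - have inv : rho1 s *m rho1 s^-1%g = 1%:M by rewrite -rho1_M mulgV.
    by have [] := mulmx1_unit inv.
  - split; first exact: rho1_trig.
    exact: (trig_pgroup_unitriangular chA G_pgroup rho1_1 rho1_M (rho1_trig s sH)).
(* If L(P) is at most a line, the L_i give a complete flag, starting with 0 in
   place of L(0), for which there is no module. *)
have [D1|D1] := leqP (D 1%N) 1.
  pose d i := if i is 0 then 0%N else D i.
  have dm : d m = n by rewrite -Dm; case: (m) m_gt0.
  have d_step i : (i < m)%N -> (d i <= d i.+1 <= (d i).+1)%N.
    by case: i => [//|i] im; rewrite /d D_mono // D_succ.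
  have d_basis i : (1 <= i <= m)%N -> exists h : (d i <= n)%N,
      is_basis f (L f K P i) (fun l : 'I_(d i) => b (widen_ord h l)).
    by case: i => // i /VB.
  have [y [yb y_act]] := @flag_lift k Sk X f K A red red_surj A_local m N th
    thD thZ _ N_free inc incD incZ theta_inc G act incG n b d erefl d_step d_basis
    m (leqnn m).
  rewrite dm in yb y_act.
  have {}yb l : th m (y l) = b l by apply: yb.
  have [T [T1 TM TE]] := action_matrix actD actZ act1 actM (y_basis y yb).
  exists T; split=> //; first exact: (red_T y).
  move=> s sH; apply/is_trig_mxP => i l il.
  have [a [a0 /TE Ta]] := y_act s i (ltn_ord i).
  by rewrite -(a0 l il) -Ta mxE.
(* Otherwise 1 is a pole number prime to p, so m = 1 and L(mP) is spanned by a
   constant and one function with a simple pole. *)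
have [h0 L0_basis] := VB 0%N isT.
have D0 : D 0%N = 1%N.
  apply/eqP; rewrite eqn_leq (L0_basis_size P_point L0_basis) -ltnS.
  exact: leq_trans D1 (D_succ 0%N m_gt0).
have m1 : m = 1%N.
  apply/eqP; rewrite eqn_leq m_gt0 andbT; have [_ _ min] := m_pole.
  apply: min; last by rewrite dvdn1 neq_ltn prime_gt1 ?orbT.
  have [h1 _] := VB 1%N m_gt0; pose l1 : 'I_n := Ordinal (leq_trans D1 h1).
  have L1 : L f K P 1 (b l1) by apply/bD.
  right; split=> [z|/(_ _ L1)/(bD 0%N isT)]; last by rewrite D0.
  exact: L0_sub_L1 P_point L1 (basis_neq0 l1 b_basis).
have n2 : n = 2%N.
  by apply/eqP; rewrite eqn_leq -{1 2}Dm {1 2}m1 D1 (leq_trans (D_succ 0%N m_gt0)) ?D0.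
have [y yb] : exists y : 'I_n -> N m, forall l, th m (y l) = b l.
  have ex l : exists x : N m, th m x = b l.
    apply: (theta_onto red_surj thD thZ N_free mm).
    exact: (basis_in l b_basis).
  by have [y yb] := choice ex; exists y.
have [T [T1 TM TE]] := action_matrix actD actZ act1 actM (y_basis y yb).
have rhoE := red_T y T yb TE.
(* The first basis vector is a constant, hence fixed. *)
have rho_trig s : s \in H -> is_trig_mx (rho s).
  move=> sH; apply/is_trig_mxP => i l il.
  have [i0 l1] : (i = 0 :> nat) /\ (l = 1 :> nat).
    have l2 : (l < 2)%N by rewrite -n2 ltn_ord.
    by move: il l2; case: (nat_of_ord i) (nat_of_ord l) => [|?] [|[|?]].
  have Lb0 : L f K P 0 (b i) by apply/bD => //; rewrite i0 D0.
  have [c bE] := L0_const P_point L0_basis Lb0.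
  have row_i : row i (rho s) = delta_mx 0 i.
    apply: b_inj; rewrite lincomb_delta.
    have pull := rho_action s sH i.
    have pull' : is_pullback_fun (alpha s) (b i) (b i).
      by rewrite bE; apply: pullback_const.
    rewrite -(uniq_pull K s _ _ _ pull pull').
    by apply: eq_bigr => q _; rewrite mxE.
  have /rowP/(_ l) := row_i; rewrite !mxE => ->.
  by rewrite (gtn_eqF il : (l == i) = false) andbF.
have HE := stabilizer_ppartE alpha P G_pgroup.
have Hgrp : group_set H by rewrite /H HE; apply: stabilizer_group_set.
clear Dm; subst n.
have ntH : H != 1%g := P_wild.
have [s sH|s sH|E [E_unit redE] E_trig] :=
    @lift_trig_pgroup2 A k red p G (Group Hgrp) T A_local chA G_pgroup ntH T1 TM.
- by rewrite rhoE //; apply: rho_trig.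
- by rewrite rhoE //; apply: rho_faithful.
exists (fun s => E *m T s *m invmx E); split=> //.
- by rewrite T1 mulmx1 mulmxV.
- by move=> s t; rewrite TM !mulmxA mulmxKV.
- move=> s sH; rewrite !map_mxM redE mul1mx rhoE //.
  have redV : map_mx red (invmx E) = 1%:M.
    by rewrite -[LHS]mul1mx -[in LHS]redE -map_mxM mulmxV // map_mx1.
  by rewrite redV mulmx1.
Qed.
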